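(* Let $\mathcal C$ be a Krull-Schmidt abelian strict tensor category over $\mathbb F$ satisfying the standing assumptions in the context, and let $\widehat{\mathcal C}$ be the tensor category constructed from the data $(r(\mathcal C),A(\mathcal C),\phi_{\mathcal C},\{a_{i,j,l}\}_{i,j,l\in I})$ attached to $\mathcal C$ as described in the context. Then $\widehat{\mathcal C}$ and $\mathcal C$ are tensor equivalent.
   Context: **Standing assumptions on $\mathcal C$.** $\mathbb F$ is an algebraically closed field. $\mathcal C$ is an $\mathbb F$-linear abelian Krull-Schmidt category with finitely many indecomposable objects up to isomorphism and finite dimensional Hom-spaces; it is a strict tensor (= monoidal) category with $\mathbb F$-bilinear tensor product $\otimes$, simple unit object $\mathbf 1$, and $U\otimes W\ne0$ for all nonzero objects $U,W$. All functors are assumed $\mathbb F$-linear. Let $I=\{1,\dots,n\}$ and let $V_1=\mathbf 1,V_2,\dots,V_n$ be representatives of the isomorphism classes of indecomposable objects. **Auslander algebra.** $V=\bigoplus_{i\in I}V_i$ with canonical $\pi_i:V\to V_i$, $\tau_i:V_i\to V$; $A=A(\mathcal C)=\mathrm{End}_{\mathcal C}(V)$, $e_i=\tau_i\pi_i$ (orthogonal idempotents with sum $1$). **Matrices.** $\mathbb N=\{0,1,2,\dots\}$. For $\mathbf m=(m_1,\dots,m_n)\in\mathbb N^I$ put $|\mathbf m|=\sum_i m_i$; $\mathbf 0=(0,\dots,0)$ and $\mathbf e_i\in\mathbb N^I$ is the $i$-th standard vector. For nonzero $\mathbf m,\mathbf s$, an $(\mathbf m,\mathbf s)$-type matrix over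 $A$ is a $|\mathbf m|\times|\mathbf s|$ block matrix $X=(X_{ij})_{i,j\in I}$ with $X_{ij}\in M_{m_i\times s_j}(e_iAe_j)$ (block rows with $m_i=0$ and block columns with $s_j=0$ are absent). If $\mathbf m=\mathbf 0$ or $\mathbf s=\mathbf 0$, the only $(\mathbf m,\mathbf s)$-type matrix is the zero matrix of size $\max(1,|\mathbf m|)\times\max(1,|\mathbf s|)$. $M_{\mathbf m\times\mathbf s}(A)$ is the space of such matrices, $M_{\mathbf m}(A)=M_{\mathbf m\times\mathbf m}(A)$ with unity $E_{\mathbf m}$, the block diagonal matrix with $i$-th block $e_i$ times the identity of size $m_i$; $E_{\mathbf 0}=0$. A $1\times1$ matrix is identified with its entry, so $M_{\mathbf e_i\times\mathbf e_j}(A)=e_iAe_j$. **Identification.** $\mathrm{Hom}_{\mathcal C}(V_i,V_j)$ is identified with $e_jAe_i$ via $f\mapsto\tau_jf\pi_i$. For $\mathbf m\in\mathbb N^I$, $V^{(\mathbf m)}=\bigoplus_i m_iV_i$ (ordered direct sum, $m_iV_i$ being $m_i$ copies of $V_i$), and $\mathrm{Hom}_{\mathcal C}(V^{(\mathbf m)},V^{(\mathbf s)})$ is identified with $M_{\mathbf s\times\mathbf m}(A)$ by taking components; composition becomes matrix multiplication. For $m_i>0$, $1\le k\le m_i$, $Y^{\mathbf m}_{i,k}\in M_{\mathbf e_i\times\mathbf m}(A)$ is the row with $e_i$ in position $k+\sum_{l<i}m_l$ and $0$ elsewhere (projection to the $k$-th copy of $V_i$), and $X^{\mathbf m}_{i,k}\in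 M_{\mathbf m\times\mathbf e_i}(A)$ is its transpose (the embedding). **Green ring and $\phi_{\mathcal C}$.** $r(\mathcal C)$ is the abelian group generated by isomorphism classes $[W]$ modulo $[W\oplus W']=[W]+[W']$, with product $[W][W']=[W\otimes W']$. Write $[V_i][V_j]=\sum_kc_{ijk}[V_k]$, $\mathbf c_{ij}=(c_{ij1},\dots,c_{ijn})\in\mathbb N^I$. Fix isomorphisms $\theta_{ij}:V_i\otimes V_j\to V^{(\mathbf c_{ij})}$ with $\theta_{1i}=\theta_{i1}=\mathrm{id}_{V_i}$. $M(\mathcal C)=\bigoplus_{i,i',j,j'}M_{\mathbf c_{i'j'}\times\mathbf c_{ij}}(A)$ is an algebra in which the product of $X$ in the summand $M_{\mathbf c_{i'j'}\times\mathbf c_{ij}}(A)$ and $Y$ in the summand $M_{\mathbf c_{i''j''}\times\mathbf c_{i_1j_1}}(A)$ is the matrix product if $(i,j)=(i'',j'')$ and $0$ otherwise. $\phi_{\mathcal C}:A\otimes_{\mathbb F}A\to M(\mathcal C)$ is the algebra map given by $\phi_{\mathcal C}(x\otimes_{\mathbb F}y)=\theta_{i'j'}(x\otimes y)\theta_{ij}^{-1}\in M_{\mathbf c_{i'j'}\times\mathbf c_{ij}}(A)$ for $x\in e_{i'}Ae_i=\mathrm{Hom}(V_i,V_{i'})$, $y\in e_{j'}Ae_j=\mathrm{Hom}(V_j,V_{j'})$. **The product $\widehat\otimes$.** $\mathbf m\widehat\otimes\mathbf s=\sum_{i,j}m_is_j\mathbf c_{ij}$ (associative, with unit $\mathbf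 e_1$). Let $X=(x_{pp'})\in M_{\mathbf s_1\times\mathbf m_1}(A)$, $Y=(y_{qq'})\in M_{\mathbf s_2\times\mathbf m_2}(A)$. If $\mathbf m_1\widehat\otimes\mathbf m_2=\mathbf 0$ or $\mathbf s_1\widehat\otimes\mathbf s_2=\mathbf 0$, $X\widehat\otimes Y$ is the zero element of $M_{(\mathbf s_1\widehat\otimes\mathbf s_2)\times(\mathbf m_1\widehat\otimes\mathbf m_2)}(A)$. Otherwise let $X\otimes_{\mathbb F}Y$ be the $|\mathbf s_1||\mathbf s_2|\times|\mathbf m_1||\mathbf m_2|$ matrix over $A\otimes_{\mathbb F}A$ whose entry in row $(q-1)|\mathbf s_1|+p$ and column $(q'-1)|\mathbf m_1|+p'$ is $x_{pp'}\otimes y_{qq'}$; apply $\phi_{\mathcal C}$ to every entry (an entry in $e_{i'}Ae_i\otimes e_{j'}Ae_j$ gives a block of type $(\mathbf c_{i'j'},\mathbf c_{ij})$); then $X\widehat\otimes Y=\Pi(\phi_{\mathcal C}(X\otimes_{\mathbb F}Y))\in M_{(\mathbf s_1\widehat\otimes\mathbf s_2)\times(\mathbf m_1\widehat\otimes\mathbf m_2)}(A)$, where $\Pi$ permutes rows so that first come all rows of idempotent type $1$ (from the first block row, then the second, ..., keeping the order inside each block), then those of type $2$, etc., and permutes columns in the same way. **Associator system.** For $\mathbf m_1=(m_{1i}),\mathbf m_2=(m_{2i})$, $\theta(\mathbf m_1,\mathbf m_2):V^{(\mathbf m_1)}\otimes V^{(\mathbf m_2)}\to V^{(\mathbf m_1\widehat\otimes\mathbf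 m_2)}$ is $0$ if $\mathbf m_1=\mathbf 0$ or $\mathbf m_2=\mathbf 0$, and otherwise $$\theta(\mathbf m_1,\mathbf m_2)=\sum_{i,j=1}^n\sum_{1\le k_1\le m_{1i}}\sum_{1\le k_2\le m_{2j}}(X^{\mathbf m_1}_{i,k_1}\widehat\otimes X^{\mathbf m_2}_{j,k_2})\,\theta_{ij}\,(Y^{\mathbf m_1}_{i,k_1}\otimes Y^{\mathbf m_2}_{j,k_2});$$ it is an isomorphism. Put $$a_{i,j,l}=\theta(\mathbf e_i,\mathbf c_{jl})(e_i\otimes\theta_{jl})(\theta_{ij}^{-1}\otimes e_l)\theta(\mathbf c_{ij},\mathbf e_l)^{-1}\in M_{\mathbf e_i\widehat\otimes\mathbf e_j\widehat\otimes\mathbf e_l}(A),$$ where $e_i=\mathrm{id}_{V_i}$. For $\mathbf m,\mathbf s,\mathbf t\in\mathbb N^I$ put $a_{\mathbf m,\mathbf s,\mathbf t}=0$ if $\mathbf m\widehat\otimes\mathbf s\widehat\otimes\mathbf t=\mathbf 0$ and otherwise $$a_{\mathbf m,\mathbf s,\mathbf t}=\sum_{i,j,l:\,m_is_jt_l>0}\sum_{k_1=1}^{m_i}\sum_{k_2=1}^{s_j}\sum_{k_3=1}^{t_l}\bigl(X^{\mathbf m}_{i,k_1}\widehat\otimes(X^{\mathbf s}_{j,k_2}\widehat\otimes X^{\mathbf t}_{l,k_3})\bigr)a_{i,j,l}\bigl((Y^{\mathbf m}_{i,k_1}\widehat\otimes Y^{\mathbf s}_{j,k_2})\widehat\otimes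 Y^{\mathbf t}_{l,k_3}\bigr).$$ **The tensor category $\widehat{\mathcal C}$.** Objects: $\mathbb N^I$; $\mathrm{Hom}_{\widehat{\mathcal C}}(\mathbf m,\mathbf s)=M_{\mathbf s\times\mathbf m}(A)$; composition is matrix multiplication; tensor product $\widehat\otimes$; unit object $\mathbf e_1$; associativity constraint $a_{\mathbf m,\mathbf s,\mathbf t}:(\mathbf m\widehat\otimes\mathbf s)\widehat\otimes\mathbf t\to\mathbf m\widehat\otimes(\mathbf s\widehat\otimes\mathbf t)$; left and right unit constraints are identities. **Tensor equivalence.** Two tensor categories are tensor equivalent if there is a tensor functor $(F,\varphi_0,\varphi_2)$ between them ($\varphi_0:\mathbf 1\to F(\mathbf 1)$ an isomorphism, $\varphi_2(U,W):F(U)\otimes F(W)\to F(U\otimes W)$ natural isomorphisms compatible with associativity and unit constraints) with $F$ an equivalence of categories. *)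

(* Defs.v *)
From HB Require Import structures.
From mathcomp Require Import all_boot all_order all_algebra.
From mathcomp Require Import boolp classical_sets.

Set Implicit Arguments.
Unset Strict Implicit.
Unset Printing Implicit Defensive.

Import GRing.Theory.
Local Open Scope ring_scope.

Record lincat (F : fieldType) := Lincat {
  ob :> Type;
  hom : ob -> ob -> lmodType F;
  idm : forall X, hom X X;
  comp : forall X Y Z, hom Y Z -> hom X Y -> hom X Z;
  comp1m : forall X Y (f : hom X Y), comp (idm Y) f = f;
  compm1 : forall X Y (f : hom X Y), comp f (idm X) = f;
  compA : forall W X Y Z (h : hom Y Z) (g : hom X Y) (f : hom W X),
    comp h (comp g f) = comp (comp h g) f;
  comp_linl : forall X Y Z (f : hom X Y) a (g g' : hom Y Z),
    comp (a *: g + g') f = a *: comp g f + comp g' f;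
  comp_linr : forall X Y Z (g : hom Y Z) a (f f' : hom X Y),
    comp g (a *: f + f') = a *: comp g f + comp g f' }.

Arguments hom {F l} _ _.
Arguments idm {F l} X.
Arguments comp {F l X Y Z} _ _.
Notation "g \oC f" := (comp g f) (at level 39, left associativity).

Section CategoryTheory.
Variables (F : fieldType) (C : lincat F).
Implicit Types X Y Z : C.

Lemma compDl X Y Z (f : hom X Y) (g g' : hom Y Z) :
  (g + g') \oC f = g \oC f + g' \oC f.
Proof. by have := comp_linl f 1 g g'; rewrite !scale1r. Qed.

Lemma compDr X Y Z (g : hom Y Z) (f f' : hom X Y) :
  g \oC (f + f') = g \oC f + g \oC f'.
Proof. by have := comp_linr g 1 f f'; rewrite !scale1r. Qed.

Lemma comp0l X Y Z (f : hom X Y) : (0 : hom Y Z) \oC f = 0.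
Proof. by apply: (addrI (0 \oC f)); rewrite -compDl !addr0. Qed.

Lemma comp0r X Y Z (g : hom Y Z) : g \oC (0 : hom X Y) = 0.
Proof. by apply: (addrI (g \oC 0)); rewrite -compDr !addr0. Qed.

Lemma compZl X Y Z (f : hom X Y) a (g : hom Y Z) :
  (a *: g) \oC f = a *: (g \oC f).
Proof. by have := comp_linl f a g 0; rewrite comp0l !addr0. Qed.

Lemma compZr X Y Z (g : hom Y Z) a (f : hom X Y) :
  g \oC (a *: f) = a *: (g \oC f).
Proof. by have := comp_linr g a f 0; rewrite comp0r !addr0. Qed.

Definition eqhom X Y (e : X = Y) : hom X Y :=
  match e in _ = Z return hom X Z with erefl => idm X end.

Definition inverse X Y (f : hom X Y) (g : hom Y X) : Prop :=
  g \oC f = idm X /\ f \oC g = idm Y.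

Definition is_iso X Y (f : hom X Y) : Prop := exists g, inverse f g.

Definition isomorphic X Y : Prop := exists f : hom X Y, is_iso f.

(* The inverse of an isomorphism; 0 on morphisms that are not invertible. *)
Definition invm X Y (f : hom X Y) : hom Y X :=
  xget 0 [set g | inverse f g]%classic.

Definition is_mono X Y (f : hom X Y) : Prop :=
  forall Z (g h : hom Z X), f \oC g = f \oC h -> g = h.

Definition is_epi X Y (f : hom X Y) : Prop :=
  forall Z (g h : hom Y Z), g \oC f = h \oC f -> g = h.

Definition is_kernel X Y (f : hom X Y) K (k : hom K X) : Prop :=
  f \oC k = 0 /\
  forall Z (h : hom Z X), f \oC h = 0 -> exists! u : hom Z K, k \oC u = h.

Definition is_cokernel X Y (f : hom X Y) K (k : hom Y K) : Prop :=
  k \oC f = 0 /\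
  forall Z (h : hom Y Z), h \oC f = 0 -> exists! u : hom K Z, u \oC k = h.

Definition is_zero X : Prop :=
  forall Y, (forall f : hom X Y, f = 0) /\ (forall f : hom Y X, f = 0).

(* A direct sum structure on the object S for the family X. *)
Record dsum (J : finType) (X : J -> C) (S : C) := Dsum {
  dpr : forall j, hom S (X j);
  dinj : forall j, hom (X j) S;
  dpr_inj : forall j, dpr j \oC dinj j = idm (X j);
  dpr_inj0 : forall j k, j != k -> dpr j \oC dinj k = 0;
  dsum_id : \sum_j (dinj j \oC dpr j) = idm S }.

Definition pair_family X Y (b : bool) : C := if b then X else Y.

Definition indecomposable X : Prop :=
  ~ is_zero X /\
  forall Y Z, dsum (pair_family Y Z) X -> is_zero Y \/ is_zero Z.

Definition simple_object X : Prop :=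
  ~ is_zero X /\ forall Y (f : hom Y X), is_mono f -> is_zero Y \/ is_iso f.

(* The endomorphism ring of X is local: it is not trivial, and the sum of two
   non-units is a non-unit. *)
Definition local_end X : Prop :=
  idm X <> 0 /\
  forall f g : hom X X, is_iso (f + g) -> is_iso f \/ is_iso g.

Record is_abelian : Prop := IsAbelian {
  abelian_zero : exists Z : C, is_zero Z;
  abelian_dsum : forall X Y, exists S, inhabited (dsum (pair_family X Y) S);
  abelian_ker : forall X Y (f : hom X Y),
    exists K (k : hom K X), is_kernel f k;
  abelian_coker : forall X Y (f : hom X Y),
    exists K (k : hom Y K), is_cokernel f k;
  abelian_mono : forall X Y (f : hom X Y), is_mono f ->
    exists Z (g : hom Y Z), is_kernel g f;
  abelian_epi : forall X Y (f : hom X Y), is_epi f ->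
    exists Z (g : hom Z X), is_cokernel g f }.

Definition krull_schmidt : Prop :=
  forall X, exists (k : nat) (Y : 'I_k -> C),
    inhabited (dsum Y X) /\ forall j, local_end (Y j).

Definition hom_finite : Prop :=
  forall X Y, exists (k : nat) (b : 'I_k -> hom X Y),
    forall f, exists a : 'I_k -> F, f = \sum_i a i *: b i.

End CategoryTheory.

Definition endo (F : fieldType) (C : lincat F) (X : C) : Type := hom X X.

HB.instance Definition _ (F : fieldType) (C : lincat F) (X : C) :=
  GRing.Lmodule.on (endo X).

HB.instance Definition _ (F : fieldType) (C : lincat F) (X : C) :=
  GRing.Zmodule_isPzRing.Build (endo X)
    (fun h g f : endo X => @compA F C X X X X h g f)
    (fun f : endo X => comp1m f) (fun f : endo X => compm1 f)
    (fun g g' f : endo X => compDl f g g')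
    (fun g f f' : endo X => compDr g f f').

Record functor (F : fieldType) (C D : lincat F) := Functor {
  fob :> C -> D;
  fmor : forall X Y : C, hom X Y -> hom (fob X) (fob Y);
  fmor_id : forall X : C, fmor (idm X) = idm (fob X);
  fmor_comp : forall (X Y Z : C) (g : hom Y Z) (f : hom X Y),
    fmor (g \oC f) = fmor g \oC fmor f;
  fmor_lin : forall (X Y : C) a (f g : hom X Y),
    fmor (a *: f + g) = a *: fmor f + fmor g }.

Arguments fmor {F C D} _ {X Y} _.

Definition functor_id (F : fieldType) (C : lincat F) : functor C C :=
  @Functor F C C id (fun _ _ f => f) (fun _ => erefl)
    (fun _ _ _ _ _ => erefl) (fun _ _ _ _ _ => erefl).

Program Definition functor_comp (F : fieldType) (C D E : lincat F)
    (G : functor D E) (H : functor C D) : functor C E :=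
  @Functor F C E (fun X => G (H X)) (fun _ _ f => fmor G (fmor H f)) _ _ _.
Next Obligation. by move=> *; rewrite !fmor_id. Qed.
Next Obligation. by move=> *; rewrite !fmor_comp. Qed.
Next Obligation. by move=> *; rewrite !fmor_lin. Qed.

Definition natural_iso (F : fieldType) (C D : lincat F) (G H : functor C D) :=
  exists eta : forall X : C, hom (G X) (H X),
    (forall X, is_iso (eta X)) /\
    forall (X Y : C) (f : hom X Y), eta Y \oC fmor G f = fmor H f \oC eta X.

Definition is_equivalence (F : fieldType) (C D : lincat F) (G : functor C D) :=
  exists H : functor D C,
    natural_iso (functor_comp H G) (functor_id C) /\
    natural_iso (functor_comp G H) (functor_id D).

Record tensor_data (F : fieldType) (C : lincat F) := TensorData {
  tens : C -> C -> C;
  tensm : forall X X' Y Y' : C,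
    hom X X' -> hom Y Y' -> hom (tens X Y) (tens X' Y');
  tunit : C;
  tassoc : forall X Y Z : C, hom (tens (tens X Y) Z) (tens X (tens Y Z));
  tlunit : forall X : C, hom (tens tunit X) X;
  trunit : forall X : C, hom (tens X tunit) X }.

Arguments tens {F C} t _ _.
Arguments tensm {F C} t {X X' Y Y'} _ _.
Arguments tunit {F C} t.
Arguments tassoc {F C} t _ _ _.
Arguments tlunit {F C} t _.
Arguments trunit {F C} t _.

Section TensorCategories.
Variables (F : fieldType) (C : lincat F) (T : tensor_data C).
Local Notation "X '⊗' Y" := (tens T X Y) (at level 38, left associativity).
Local Notation "f '⊠' g" := (tensm T f g) (at level 38, left associativity).

Record is_tensor_category : Prop := IsTensorCategory {
  tens_id : forall X Y : C, idm X ⊠ idm Y = idm (X ⊗ Y);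
  tens_comp : forall (X X' X'' Y Y' Y'' : C)
    (f' : hom X' X'') (f : hom X X') (g' : hom Y' Y'') (g : hom Y Y'),
    (f' \oC f) ⊠ (g' \oC g) = (f' ⊠ g') \oC (f ⊠ g);
  tens_linl : forall (X X' Y Y' : C) (g : hom Y Y') a (f f' : hom X X'),
    (a *: f + f') ⊠ g = a *: (f ⊠ g) + f' ⊠ g;
  tens_linr : forall (X X' Y Y' : C) (f : hom X X') a (g g' : hom Y Y'),
    f ⊠ (a *: g + g') = a *: (f ⊠ g) + f ⊠ g';
  tassoc_iso : forall X Y Z : C, is_iso (tassoc T X Y Z);
  tassoc_nat : forall (X X' Y Y' Z Z' : C)
    (f : hom X X') (g : hom Y Y') (h : hom Z Z'),
    tassoc T X' Y' Z' \oC ((f ⊠ g) ⊠ h) = (f ⊠ (g ⊠ h)) \oC tassoc T X Y Z;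
  tlunit_iso : forall X : C, is_iso (tlunit T X);
  tlunit_nat : forall (X X' : C) (f : hom X X'),
    tlunit T X' \oC (idm (tunit T) ⊠ f) = f \oC tlunit T X;
  trunit_iso : forall X : C, is_iso (trunit T X);
  trunit_nat : forall (X X' : C) (f : hom X X'),
    trunit T X' \oC (f ⊠ idm (tunit T)) = f \oC trunit T X;
  tpentagon : forall W X Y Z : C,
    tassoc T W X (Y ⊗ Z) \oC tassoc T (W ⊗ X) Y Z =
    (idm W ⊠ tassoc T X Y Z) \oC tassoc T W (X ⊗ Y) Z
      \oC (tassoc T W X Y ⊠ idm Z);
  ttriangle : forall X Y : C,
    (idm X ⊠ tlunit T Y) \oC tassoc T X (tunit T) Y = trunit T X ⊠ idm Y }.

(* Strictness: the two sides of each constraint are the same object, and the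
   constraint is the identity. *)
Definition is_strict : Prop :=
  [/\ exists e : forall X Y Z : C, X ⊗ Y ⊗ Z = X ⊗ (Y ⊗ Z),
        forall X Y Z, tassoc T X Y Z = eqhom (e X Y Z),
      exists e : forall X : C, tunit T ⊗ X = X,
        forall X, tlunit T X = eqhom (e X)
    & exists e : forall X : C, X ⊗ tunit T = X,
        forall X, trunit T X = eqhom (e X)].

Record standing_assumptions : Prop := StandingAssumptions {
  sa_abelian : is_abelian C;
  sa_krull_schmidt : krull_schmidt C;
  sa_hom_finite : hom_finite C;
  sa_tensor : is_tensor_category;
  sa_strict : is_strict;
  sa_unit_simple : simple_object (tunit T);
  sa_tens_neq0 : forall U W : C,
    ~ is_zero U -> ~ is_zero W -> ~ is_zero (U ⊗ W) }.

End TensorCategories.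

Record tensor_functor (F : fieldType) (C D : lincat F)
    (TC : tensor_data C) (TD : tensor_data D) := TensorFunctor {
  tfun :> functor C D;
  tphi0 : hom (tunit TD) (tfun (tunit TC));
  tphi2 : forall X Y : C, hom (tens TD (tfun X) (tfun Y)) (tfun (tens TC X Y));
  tphi0_iso : is_iso tphi0;
  tphi2_iso : forall X Y : C, is_iso (tphi2 X Y);
  tphi2_nat : forall (X X' Y Y' : C) (f : hom X X') (g : hom Y Y'),
    tphi2 X' Y' \oC tensm TD (fmor tfun f) (fmor tfun g) =
    fmor tfun (tensm TC f g) \oC tphi2 X Y;
  tfun_assoc : forall X Y Z : C,
    fmor tfun (tassoc TC X Y Z) \oC tphi2 (tens TC X Y) Z
      \oC tensm TD (tphi2 X Y) (idm (tfun Z)) =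
    tphi2 X (tens TC Y Z) \oC tensm TD (idm (tfun X)) (tphi2 Y Z)
      \oC tassoc TD (tfun X) (tfun Y) (tfun Z);
  tfun_lunit : forall X : C,
    fmor tfun (tlunit TC X) \oC tphi2 (tunit TC) X
      \oC tensm TD tphi0 (idm (tfun X)) = tlunit TD (tfun X);
  tfun_runit : forall X : C,
    fmor tfun (trunit TC X) \oC tphi2 X (tunit TC)
      \oC tensm TD (idm (tfun X)) tphi0 = trunit TD (tfun X) }.

Definition tensor_equivalent (F : fieldType) (C D : lincat F)
    (TC : tensor_data C) (TD : tensor_data D) : Prop :=
  exists G : tensor_functor TC TD, is_equivalence G.

(* r(C), presented by generators and relations: expressions in the generators
   [W], and the congruence generated by the abelian group laws, by [W] = [W']
   for isomorphic W, W', and by [W + W'] = [W] + [W']. *)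
Inductive green_expr (O : Type) :=
  | GCls of O
  | GZero
  | GOpp of green_expr O
  | GAdd of green_expr O & green_expr O.

Arguments GZero {O}.

Inductive green_eq (F : fieldType) (C : lincat F) :
    green_expr C -> green_expr C -> Prop :=
  | GRefl x : green_eq x x
  | GSym x y : green_eq x y -> green_eq y x
  | GTrans x y z : green_eq x y -> green_eq y z -> green_eq x z
  | GCongOpp x y : green_eq x y -> green_eq (GOpp x) (GOpp y)
  | GCongAdd x x' y y' :
      green_eq x x' -> green_eq y y' -> green_eq (GAdd x y) (GAdd x' y')
  | GAddA x y z : green_eq (GAdd x (GAdd y z)) (GAdd (GAdd x y) z)
  | GAddC x y : green_eq (GAdd x y) (GAdd y x)
  | GAdd0 x : green_eq (GAdd GZero x) x
  | GAddN x : green_eq (GAdd (GOpp x) x) GZero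
  | GIso (X Y : C) : isomorphic X Y -> green_eq (GCls X) (GCls Y)
  | GSum (X Y S : C) : dsum (pair_family X Y) S ->
      green_eq (GCls S) (GAdd (GCls X) (GCls Y)).

Definition delta (n : nat) (i : 'I_n) : {ffun 'I_n -> nat} :=
  [ffun k => nat_of_bool (k == i)].

(* The choices made for a strict tensor category.  The index set {1, ..., n} is
   'I_n.+1 here, the index of the unit object being ord0.  V^(e_i) is not
   required to be V_i on the nose: the two are identified by the structure maps
   of the direct sum V^(e_i), and it is through this identification that
   theta_{1i} and theta_{i1} are identities. *)
Record frame (F : fieldType) (C : lincat F) (T : tensor_data C) := Frame {
  fr_n : nat;
  fr_V : 'I_fr_n.+1 -> C;
  fr_V0 : fr_V ord0 = tunit T;
  fr_V_indec : forall i, indecomposable (fr_V i);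
  fr_V_uniq : forall i j, isomorphic (fr_V i) (fr_V j) -> i = j;
  fr_V_all : forall X : C, indecomposable X -> exists i, isomorphic X (fr_V i);
  fr_sum : C;
  fr_sumP : dsum fr_V fr_sum;
  fr_Vm : {ffun 'I_fr_n.+1 -> nat} -> C;
  fr_VmP : forall m : {ffun 'I_fr_n.+1 -> nat},
    dsum (fun z : {i : 'I_fr_n.+1 & 'I_(m i)} => fr_V (tag z)) (fr_Vm m);
  fr_c : 'I_fr_n.+1 -> 'I_fr_n.+1 -> {ffun 'I_fr_n.+1 -> nat};
  fr_c_green : forall i j,
    green_eq (GCls (tens T (fr_V i) (fr_V j)))
      (\big[@GAdd C/GZero]_k iter (fr_c i j k) (GAdd (GCls (fr_V k))) GZero);
  fr_c_unitl : forall i, fr_c ord0 i = delta i;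
  fr_c_unitr : forall i, fr_c i ord0 = delta i;
  fr_theta : forall i j, hom (tens T (fr_V i) (fr_V j)) (fr_Vm (fr_c i j));
  fr_theta_iso : forall i j, is_iso (fr_theta i j);
  fr_theta_unitl : forall i (k : 'I_(fr_c ord0 i i)),
    fr_theta ord0 i =
    dinj (fr_VmP (fr_c ord0 i)) (Tagged (fun j => 'I_(fr_c ord0 i j)) k)
      \oC tlunit T (fr_V i) \oC tensm T (eqhom fr_V0) (idm (fr_V i));
  fr_theta_unitr : forall i (k : 'I_(fr_c i ord0 i)),
    fr_theta i ord0 =
    dinj (fr_VmP (fr_c i ord0)) (Tagged (fun j => 'I_(fr_c i ord0 j)) k)
      \oC trunit T (fr_V i) \oC tensm T (idm (fr_V i)) (eqhom fr_V0) }.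

Arguments fr_V {F C T} f _.
Arguments fr_sum {F C T} f.
Arguments fr_sumP {F C T} f.
Arguments fr_Vm {F C T} f _.
Arguments fr_VmP {F C T} f _.
Arguments fr_c {F C T} f _ _.
Arguments fr_theta {F C T} f _ _.
Arguments dpr {F C J X S} d j.
Arguments dinj {F C J X S} d j.

Section Hat.
Variables (F : fieldType) (C : lincat F) (T : tensor_data C) (D : frame T).

Local Notation I := 'I_(fr_n D).+1.
Local Notation NI := {ffun I -> nat}.
Local Notation V := (fr_V D).
Local Notation Vm := (fr_Vm D).
Local Notation c := (fr_c D).
Local Notation theta := (fr_theta D).

Definition auslander : Type := endo (fr_sum D).
HB.instance Definition _ := GRing.PzRing.on auslander.
HB.instance Definition _ := GRing.Lmodule.on auslander.

Definition idem (i : I) : auslander :=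
  dinj (fr_sumP D) i \oC dpr (fr_sumP D) i.

Lemma idem_id i : idem i * idem i = idem i.
Proof.
rewrite /idem; change (dinj (fr_sumP D) i \oC dpr (fr_sumP D) i \oC
  (dinj (fr_sumP D) i \oC dpr (fr_sumP D) i) =
  dinj (fr_sumP D) i \oC dpr (fr_sumP D) i).
by rewrite compA -(compA _ (dpr _ _)) dpr_inj compm1.
Qed.

(* A row or column position of a block matrix of type m, and the index of the
   block containing it; tagnat orders positions by block first. *)
Local Notation pos m := 'I_(\sum_i fun_of_fin m i)%N.
Local Notation blk p := (tagnat.sig1 p).

(* x \in e_i A e_j is written e_i x e_j = x.  There are no rows (columns) at
   all when s = 0 (m = 0), so the space is then reduced to 0. *)
Definition is_block (s m : NI) :
    {pred 'M[auslander]_(\sum_i s i, \sum_i m i)} :=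
  fun X => [forall p, forall q, idem (blk p) * X p q * idem (blk q) == X p q].

Lemma is_blockP (s m : NI) (X : 'M[auslander]_(\sum_i s i, \sum_i m i)) :
  reflect (forall p q, idem (blk p) * X p q * idem (blk q) = X p q)
    (X \in @is_block s m).
Proof.
apply: (iffP forallP) => [h p q | h p]; first by apply/eqP/(forallP (h p)).
by apply/forallP => q; apply/eqP.
Qed.

Fact is_block_zmod_closed s m : zmod_closed (@is_block s m).
Proof.
split=> [|X Y /is_blockP hX /is_blockP hY]; apply/is_blockP => p q.
  by rewrite mxE mulr0 mul0r.
by rewrite !mxE mulrDr mulrDl mulrN mulNr hX hY.
Qed.

HB.instance Definition _ (s m : NI) :=
  GRing.isZmodClosed.Build _ (@is_block s m) (@is_block_zmod_closed s m).

Record blockmx (s m : NI) := BlockMx {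
  blockmx_val :> 'M[auslander]_(\sum_i s i, \sum_i m i);
  blockmxP : blockmx_val \in @is_block s m }.

HB.instance Definition _ (s m : NI) := [isSub for @blockmx_val s m].
HB.instance Definition _ (s m : NI) := [Choice of blockmx s m by <:].
HB.instance Definition _ (s m : NI) :=
  [SubChoice_isSubZmodule of blockmx s m by <:].

Lemma auslander_scalel (a : F) (x y : auslander) : (a *: x) * y = a *: (x * y).
Proof. exact: compZl. Qed.

Lemma auslander_scaler (a : F) (x y : auslander) : x * (a *: y) = a *: (x * y).
Proof. exact: compZr. Qed.

Fact blockmx_scale_subproof s m (a : F) (X : blockmx s m) :
  map_mx (fun x : auslander => a *: x) X \in @is_block s m.
Proof.
apply/is_blockP => p q; rewrite !mxE auslander_scaler auslander_scalel.
by have /is_blockP -> := blockmxP X.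
Qed.

Definition blockmx_scale s m (a : F) (X : blockmx s m) : blockmx s m :=
  BlockMx (blockmx_scale_subproof a X).

Lemma blockmx_eq s m (X Y : blockmx s m) : (forall p q, X p q = Y p q) -> X = Y.
Proof. by move=> h; apply/val_inj/matrixP. Qed.

Lemma blockmxD s m (X Y : blockmx s m) p q : (X + Y) p q = X p q + Y p q.
Proof. by rewrite [LHS]mxE. Qed.

Lemma blockmxZ s m a (X : blockmx s m) p q :
  blockmx_scale a X p q = a *: X p q.
Proof. by rewrite [LHS]mxE. Qed.

Fact blockmx_scaleA s m a b (X : blockmx s m) :
  blockmx_scale a (blockmx_scale b X) = blockmx_scale (a * b) X.
Proof. by apply: blockmx_eq => p q; rewrite !blockmxZ scalerA. Qed.
Fact blockmx_scale1 s m : left_id 1 (@blockmx_scale s m).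
Proof. by move=> X; apply: blockmx_eq => p q; rewrite blockmxZ scale1r. Qed.
Fact blockmx_scaleDr s m : right_distributive (@blockmx_scale s m) +%R.
Proof.
move=> a X Y; apply: blockmx_eq => p q.
by rewrite !(blockmxD, blockmxZ) scalerDr.
Qed.
Fact blockmx_scaleDl s m (X : blockmx s m) :
  {morph (@blockmx_scale s m)^~ X : a b / a + b}.
Proof.
move=> a b; apply: blockmx_eq => p q.
by rewrite !(blockmxD, blockmxZ) scalerDl.
Qed.

HB.instance Definition _ (s m : NI) :=
  GRing.Zmodule_isLmodule.Build F (blockmx s m) (@blockmx_scaleA s m)
    (@blockmx_scale1 s m) (@blockmx_scaleDr s m) (@blockmx_scaleDl s m).

Lemma blockmx_id_subproof (m : NI) :
  \matrix_(p, q) (if p == q then idem (blk p) else 0) \in @is_block m m.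
Proof.
apply/is_blockP => p q; rewrite !mxE; case: eqP => [<-|_].
  by rewrite !idem_id.
by rewrite mulr0 mul0r.
Qed.

Definition blockmx_id m : blockmx m m := BlockMx (blockmx_id_subproof m).

Lemma blockmx_mul_subproof s m r (X : blockmx s m) (Y : blockmx m r) :
  (X : 'M__) *m Y \in @is_block s r.
Proof.
have /is_blockP hX := blockmxP X; have /is_blockP hY := blockmxP Y.
have idl p q : idem (blk p) * X p q = X p q by rewrite -hX !mulrA idem_id.
have idr p q : Y p q * idem (blk q) = Y p q by rewrite -hY -!mulrA idem_id.
apply/is_blockP => p q; rewrite !mxE mulr_sumr mulr_suml.
by apply: eq_bigr => k _; rewrite mulrA idl -mulrA idr.
Qed.

Definition blockmx_mul s m r (X : blockmx s m) (Y : blockmx m r) :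
  blockmx s r := BlockMx (blockmx_mul_subproof X Y).

Lemma blockmx_mul1l m s (X : blockmx s m) : blockmx_mul (blockmx_id s) X = X.
Proof.
have /is_blockP hX := blockmxP X.
have idl p q : idem (blk p) * X p q = X p q by rewrite -hX !mulrA idem_id.
apply: blockmx_eq => p q; rewrite [LHS]mxE (bigD1 p) //= mxE eqxx idl.
rewrite [X in _ + X]big1 ?addr0 // => k nk.
by rewrite mxE eq_sym (negPf nk) mul0r.
Qed.

Lemma blockmx_mul1r m s (X : blockmx s m) : blockmx_mul X (blockmx_id m) = X.
Proof.
have /is_blockP hX := blockmxP X.
have idr p q : X p q * idem (blk q) = X p q by rewrite -hX -!mulrA idem_id.
apply: blockmx_eq => p q; rewrite [LHS]mxE (bigD1 q) //= mxE eqxx idr.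
by rewrite [X in _ + X]big1 ?addr0 // => k nk; rewrite mxE (negPf nk) mulr0.
Qed.

Lemma blockmx_mulA m s r t (X : blockmx t r) (Y : blockmx r s)
    (Z : blockmx s m) :
  blockmx_mul X (blockmx_mul Y Z) = blockmx_mul (blockmx_mul X Y) Z.
Proof. by apply: val_inj; exact: mulmxA. Qed.

Lemma blockmx_lin s m (a : F) (X Y : blockmx s m) p q :
  (a *: X + Y) p q = a *: X p q + Y p q.
Proof. by rewrite blockmxD; congr (_ + _); rewrite [LHS]mxE. Qed.

Lemma blockmx_mulE m s r (X : blockmx r s) (Y : blockmx s m) p q :
  blockmx_mul X Y p q = \sum_k X p k * Y k q.
Proof. exact: mxE. Qed.

Lemma blockmx_mul_linl m s r (Y : blockmx s m) (a : F) (X X' : blockmx r s) :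
  blockmx_mul (a *: X + X') Y = a *: blockmx_mul X Y + blockmx_mul X' Y.
Proof.
apply: blockmx_eq => p q.
rewrite blockmx_lin !blockmx_mulE scaler_sumr -big_split; apply: eq_bigr => k _.
by rewrite blockmx_lin mulrDl auslander_scalel.
Qed.

Lemma blockmx_mul_linr m s r (X : blockmx r s) (a : F) (Y Y' : blockmx s m) :
  blockmx_mul X (a *: Y + Y') = a *: blockmx_mul X Y + blockmx_mul X Y'.
Proof.
apply: blockmx_eq => p q.
rewrite blockmx_lin !blockmx_mulE scaler_sumr -big_split; apply: eq_bigr => k _.
by rewrite blockmx_lin mulrDr auslander_scaler.
Qed.

Definition hat_cat : lincat F :=
  @Lincat F NI (fun m s => blockmx s m) blockmx_id
    (fun _ _ _ => @blockmx_mul _ _ _)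
    (fun _ _ => @blockmx_mul1l _ _) (fun _ _ => @blockmx_mul1r _ _)
    (fun _ _ _ _ => @blockmx_mulA _ _ _ _)
    (fun _ _ _ => @blockmx_mul_linl _ _ _)
    (fun _ _ _ => @blockmx_mul_linr _ _ _).

Definition to_alg (i j : I) (f : hom (V i) (V j)) : auslander :=
  dinj (fr_sumP D) j \oC f \oC dpr (fr_sumP D) i.

Definition of_alg (i j : I) (x : auslander) : hom (V i) (V j) :=
  dpr (fr_sumP D) j \oC x \oC dinj (fr_sumP D) i.

Definition proj (m : NI) (p : pos m) : hom (Vm m) (V (blk p)) :=
  dpr (fr_VmP D m) (tagnat.sig p).

Definition emb (m : NI) (p : pos m) : hom (V (blk p)) (Vm m) :=
  dinj (fr_VmP D m) (tagnat.sig p).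

Lemma to_alg_block i j (f : hom (V i) (V j)) :
  idem j * to_alg f * idem i = to_alg f.
Proof.
change (dinj (fr_sumP D) j \oC dpr (fr_sumP D) j \oC
  (dinj (fr_sumP D) j \oC f \oC dpr (fr_sumP D) i) \oC
  (dinj (fr_sumP D) i \oC dpr (fr_sumP D) i) =
  dinj (fr_sumP D) j \oC f \oC dpr (fr_sumP D) i).
rewrite -!compA (compA (dpr _ i)) dpr_inj comp1m.
by rewrite (compA (dpr _ j)) dpr_inj comp1m.
Qed.

Lemma to_mx_subproof m s (f : hom (Vm m) (Vm s)) :
  \matrix_(p, q) to_alg (proj p \oC f \oC emb q) \in @is_block s m.
Proof. by apply/is_blockP => p q; rewrite !mxE to_alg_block. Qed.

Definition to_mx m s (f : hom (Vm m) (Vm s)) : blockmx s m :=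
  BlockMx (to_mx_subproof f).

Definition of_mx m s (X : blockmx s m) : hom (Vm m) (Vm s) :=
  \sum_p \sum_q (emb p \oC of_alg (blk q) (blk p) (X p q) \oC proj q).

(* phi_C on a pure tensor, for x in e_i' A e_i and y in e_j' A e_j; the
   entries of X (x) Y are all of this kind. *)
Definition phi (i i' j j' : I) (x y : auslander) : blockmx (c i' j') (c i j) :=
  to_mx (theta i' j' \oC tensm T (of_alg i i' x) (of_alg j j' y)
           \oC invm (theta i j)).

Definition hat_ob (m s : NI) : NI :=
  [ffun k => (\sum_i \sum_j m i * s j * c i j k)%N].

(* The rows of phi_C(X (x) Y), for X with rows of type s1 and Y with rows of
   type s2: row r of the block coming from row p of X and row q of Y.  They are
   listed from top to bottom, q varying slower than p. *)
Definition prerow (s1 s2 : NI) : finType :=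
  {z : pos s2 * pos s1 & pos (c (blk z.2) (blk z.1))}.

Definition prerows (s1 s2 : NI) : seq (prerow s1 s2) :=
  [seq Tagged (fun z : pos s2 * pos s1 => pos (c (blk z.2) (blk z.1))) r
     | z <- [seq (q, p) | q <- enum (pos s2), p <- enum (pos s1)],
       r <- enum (pos (c (blk z.2) (blk z.1)))].

Definition prerow_type s1 s2 (u : prerow s1 s2) : I := blk (tagged u).

(* The rearrangement Pi: a stable sort by idempotent type. *)
Definition sorted_prerows s1 s2 : seq (prerow s1 s2) :=
  sort (fun u v => prerow_type u <= prerow_type v)%N (prerows s1 s2).

Lemma count_pos (m : NI) (f : I -> nat) :
  (\sum_(p : pos m) f (blk p) = \sum_i m i * f i)%N.
Proof.
rewrite (reindex (@tagnat.rank _ m)) /=; last exact/onW_bij/tagnat.rank_bij.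
under eq_bigr => z _ do rewrite /tagnat.sig1 tagnat.rankK.
rewrite -(@sig_big_dep _ _ _ _ _ xpredT (fun=> xpredT) (fun i _ => f i)) /=.
by apply: eq_bigr => i _; rewrite sum_nat_const card_ord.
Qed.

Lemma count_prerows s1 s2 (k : I) :
  count [pred u | prerow_type u == k] (prerows s1 s2) = hat_ob s1 s2 k.
Proof.
rewrite /prerows count_flatten sumnE !big_map big_allpairs_dep /= ffunE.
under eq_bigr => q _.
  under eq_bigr => p _.
    rewrite count_map -sum1_count big_mkcond big_enum /=.
    rewrite (eq_bigr (fun r => nat_of_bool (blk r == k))); last first.
      by move=> r _ /=; rewrite /prerow_type /=; case: eqP.
    rewrite (count_pos _ (fun i => nat_of_bool (i == k))).
    rewrite (bigD1 k) //= eqxx muln1 big1 ?addn0; last first.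
      by move=> i /negPf ->; rewrite muln0.
    over.
  rewrite big_enum /= (count_pos _ (fun i => c i (blk q) k)).
  over.
rewrite big_enum /= (count_pos _ (fun j => \sum_i s1 i * c i j k))%N.
rewrite exchange_big /=; apply: eq_bigr => j _; rewrite big_distrr /=.
by apply: eq_bigr => i _; rewrite mulnA (mulnC (s2 j)).
Qed.

Lemma count_blk (m : NI) (k : I) :
  count_mem k [seq blk p | p <- enum (pos m)] = m k.
Proof.
rewrite count_map -sum1_count big_mkcond big_enum /=.
rewrite (eq_bigr (fun p => nat_of_bool (blk p == k))); last first.
  by move=> p _; case: eqP.
rewrite (count_pos _ (fun i => nat_of_bool (i == k))) (bigD1 k) //= eqxx muln1.
by rewrite big1 ?addn0 // => i /negPf ->; rewrite muln0.
Qed.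

Lemma sorted_prerows_type s1 s2 :
  [seq prerow_type u | u <- sorted_prerows s1 s2] =
  [seq blk P | P <- enum (pos (hat_ob s1 s2))].
Proof.
have tr : transitive (relpre (@nat_of_ord (fr_n D).+1) leq).
  by move=> ? ? ?; apply: leq_trans.
have an : antisymmetric (relpre (@nat_of_ord (fr_n D).+1) leq).
  by move=> x y /= /anti_leq/val_inj.
apply: (sorted_eq tr an).
- rewrite sorted_map; apply: sort_sorted => u v; exact: leq_total.
- rewrite sorted_map; apply: (@sub_sorted _ (relpre val leq)).
    by move=> p q /= pq; have := @tagnat.le_sig1 _ (hat_ob s1 s2) p q pq.
  by rewrite -sorted_map val_enum_ord iota_sorted.
- rewrite /sorted_prerows; apply/allP => /= k _; apply/eqP.
  rewrite count_blk count_map -(count_prerows s1 s2 k).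
  by apply/permP; rewrite perm_sort.
Qed.

Lemma size_sorted_prerows s1 s2 :
  size (sorted_prerows s1 s2) = (\sum_i hat_ob s1 s2 i)%N.
Proof.
by rewrite -(size_map (@prerow_type s1 s2)) sorted_prerows_type size_map
           size_enum_ord.
Qed.

Definition hat_row s1 s2 (P : pos (hat_ob s1 s2)) : prerow s1 s2 :=
  tnth (in_tuple (sorted_prerows s1 s2))
    (cast_ord (esym (size_sorted_prerows s1 s2)) P).

Lemma hat_row_type s1 s2 (P : pos (hat_ob s1 s2)) :
  prerow_type (hat_row P) = blk P.
Proof.
rewrite /hat_row (tnth_nth (tnth (in_tuple (sorted_prerows s1 s2))
  (cast_ord (esym (size_sorted_prerows s1 s2)) P))) /=.
set u0 := tnth _ _.
have hP : (P < size (sorted_prerows s1 s2))%N by rewrite size_sorted_prerows.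
rewrite -(nth_map u0 (blk P) (@prerow_type s1 s2)) // sorted_prerows_type.
by rewrite (nth_map P) ?size_enum_ord // nth_ord_enum.
Qed.

Lemma hat_mx_subproof s1 s2 m1 m2 (X : blockmx s1 m1) (Y : blockmx s2 m2) :
  \matrix_(P, Q)
    (let u := hat_row P in let v := hat_row Q in
     phi (blk (tag v).2) (blk (tag u).2) (blk (tag v).1) (blk (tag u).1)
       (X (tag u).2 (tag v).2) (Y (tag u).1 (tag v).1) (tagged u) (tagged v))
  \in @is_block (hat_ob s1 s2) (hat_ob m1 m2).
Proof.
apply/is_blockP => P Q; rewrite !mxE -!hat_row_type /prerow_type.
exact/is_blockP/blockmxP.
Qed.

(* If one of the two types is 0 there are no rows (no columns), so that the
   product is the zero element. *)
Definition hat_mx s1 s2 m1 m2 (X : blockmx s1 m1) (Y : blockmx s2 m2) :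
  blockmx (hat_ob s1 s2) (hat_ob m1 m2) := BlockMx (hat_mx_subproof X Y).

Lemma blk_delta (i : I) (p : pos (delta i)) : blk p = i.
Proof.
have : (0 < delta i (blk p))%N.
  by apply: leq_ltn_trans (ltn_ord (tagnat.sig2 p)).
by rewrite ffunE; case: eqP.
Qed.

Lemma elt_col_subproof (m : NI) (i : I) (k : 'I_(m i)) :
  \matrix_(p, q) (if p == @tagnat.Rank _ m i k then idem i else 0)
    \in @is_block m (delta i).
Proof.
apply/is_blockP => p q; rewrite !mxE; case: eqP => [->|_]; last first.
  by rewrite mulr0 mul0r.
by rewrite blk_delta tagnat.Rank1K !idem_id.
Qed.

Definition elt_col (m : NI) i (k : 'I_(m i)) : blockmx m (delta i) :=
  BlockMx (elt_col_subproof k).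

Lemma elt_row_subproof (m : NI) (i : I) (k : 'I_(m i)) :
  \matrix_(p, q) (if q == @tagnat.Rank _ m i k then idem i else 0)
    \in @is_block (delta i) m.
Proof.
apply/is_blockP => p q; rewrite !mxE; case: eqP => [->|_]; last first.
  by rewrite mulr0 mul0r.
by rewrite blk_delta tagnat.Rank1K !idem_id.
Qed.

Definition elt_row (m : NI) i (k : 'I_(m i)) : blockmx (delta i) m :=
  BlockMx (elt_row_subproof k).

Lemma sum_delta (i : I) (f : I -> nat) : (\sum_j delta i j * f j = f i)%N.
Proof.
rewrite (bigD1 i) //= ffunE eqxx mul1n big1 ?addn0 // => j /negPf nj.
by rewrite ffunE nj.
Qed.

Lemma sum_delta_sym (k : I) (f : I -> nat) : (\sum_j f j * delta j k = f k)%N.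
Proof.
rewrite -(sum_delta k); apply: eq_bigr => j _.
by rewrite !ffunE eq_sym mulnC.
Qed.

Lemma hat_ob_delta i j : hat_ob (delta i) (delta j) = c i j.
Proof.
apply/ffunP => k; rewrite ffunE -(sum_delta j (fun j => c i j k)).
rewrite -[RHS](sum_delta i (fun i => \sum_j' delta j j' * c i j' k)%N).
apply: eq_bigr => i' _; rewrite big_distrr /=.
by apply: eq_bigr => j' _; rewrite mulnA.
Qed.

Lemma hat_ob_unitl m : hat_ob (delta ord0) m = m.
Proof.
apply/ffunP => k; rewrite ffunE -[RHS](sum_delta_sym k m).
rewrite -[RHS](sum_delta ord0 (fun i => \sum_j m j * delta j k)%N).
apply: eq_bigr => i _; rewrite big_distrr /=; apply: eq_bigr => j _.
rewrite [delta ord0 i]ffunE; case: eqP => [->|//].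
by rewrite !mul1n fr_c_unitl.
Qed.

Lemma hat_ob_unitr m : hat_ob m (delta ord0) = m.
Proof.
apply/ffunP => k; rewrite ffunE -[RHS](sum_delta_sym k m).
apply: eq_bigr => i _.
rewrite -[RHS](sum_delta ord0 (fun=> m i * delta i k)%N).
apply: eq_bigr => j _; rewrite [delta ord0 j]ffunE.
case: eqP => [->|]; last by rewrite muln0.
by rewrite muln1 mul1n fr_c_unitr.
Qed.

(* The projection Y^m_{i,k} and the embedding X^m_{i,k} as morphisms of C; their
   matrices are elt_row and elt_col. *)
Definition pr (m : NI) i (k : 'I_(m i)) : hom (Vm m) (V i) :=
  dpr (fr_VmP D m) (Tagged (fun j => 'I_(m j)) k).

Definition inj (m : NI) i (k : 'I_(m i)) : hom (V i) (Vm m) :=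
  dinj (fr_VmP D m) (Tagged (fun j => 'I_(m j)) k).

Lemma delta_gt0 (i : I) : (0 < delta i i)%N.
Proof. by rewrite ffunE eqxx. Qed.

(* The identification of V_i with V^(e_i). *)
Definition unit_emb (i : I) : hom (V i) (Vm (delta i)) :=
  inj (Ordinal (delta_gt0 i)).

Definition unit_proj (i : I) : hom (Vm (delta i)) (V i) :=
  pr (Ordinal (delta_gt0 i)).

Definition theta_ext (m1 m2 : NI) :
    hom (tens T (Vm m1) (Vm m2)) (Vm (hat_ob m1 m2)) :=
  \sum_i \sum_j \sum_(k1 < m1 i) \sum_(k2 < m2 j)
    (of_mx (hat_mx (elt_col k1) (elt_col k2))
       \oC eqhom (congr1 Vm (esym (hat_ob_delta i j)))
       \oC theta i j \oC tensm T (pr k1) (pr k2)).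

(* The constraint of C, an identity when C is strict, is displayed. *)
Definition assoc_core (i j l : I) :
    hom (Vm (hat_ob (c i j) (delta l))) (Vm (hat_ob (delta i) (c j l))) :=
  theta_ext (delta i) (c j l) \oC tensm T (unit_emb i) (theta j l)
    \oC tassoc T (V i) (V j) (V l)
    \oC tensm T (invm (theta i j)) (unit_proj l)
    \oC invm (theta_ext (c i j) (delta l)).

(* a_{i,j,l}, assoc_core being transported along e_i (x) e_j = c_{ij} and
   e_j (x) e_l = c_{jl}. *)
Definition assoc_basic (i j l : I) :
    @hom F hat_cat (hat_ob (hat_ob (delta i) (delta j)) (delta l))
                   (hat_ob (delta i) (hat_ob (delta j) (delta l))) :=
  @eqhom F hat_cat _ _ (congr1 (hat_ob (delta i)) (esym (hat_ob_delta j l)))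
    \oC (to_mx (assoc_core i j l) : @hom F hat_cat _ _)
    \oC @eqhom F hat_cat _ _
          (congr1 (fun m => hat_ob m (delta l)) (hat_ob_delta i j)).

Definition hat_assoc (m s t : NI) :
    @hom F hat_cat (hat_ob (hat_ob m s) t) (hat_ob m (hat_ob s t)) :=
  \sum_i \sum_j \sum_l \sum_(k1 < m i) \sum_(k2 < s j) \sum_(k3 < t l)
    ((hat_mx (elt_col k1) (hat_mx (elt_col k2) (elt_col k3))
        : @hom F hat_cat _ _)
       \oC assoc_basic i j l
       \oC (hat_mx (hat_mx (elt_row k1) (elt_row k2)) (elt_row k3)
              : @hom F hat_cat _ _)).

Definition hat_tensor : tensor_data hat_cat :=
  @TensorData F hat_cat hat_ob
    (fun _ _ _ _ X Y => hat_mx X Y) (delta ord0) hat_assoc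
    (fun m => @eqhom F hat_cat _ _ (hat_ob_unitl m))
    (fun m => @eqhom F hat_cat _ _ (hat_ob_unitr m)).

End Hat.

(* Main.v *)
Require Import Defs.
From mathcomp Require Import all_boot all_order all_algebra.
From mathcomp Require Import boolp classical_sets.
Import Defs.

(** A matrix with entries in the blocks e_i A e_j is a morphism between direct
    sums of the V_i written out in components.  Sending m to V^(m) and a matrix
    to the morphism that it describes is therefore a fully faithful functor from
    the category of block matrices to C ([realize]).  By the Krull-Schmidt
    property every object is isomorphic to some V^(m), because an object with
    local endomorphism ring is indecomposable; so the functor is an equivalence
    ([realize_essentially_surjective], [ff_es_equivalence]).

    For the tensor structure, V^(s1) ⊗ V^(s2) is the direct sum of the products
    V_i ⊗ V_j over pairs of positions, and each V_i ⊗ V_j is through theta_ij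
    the direct sum of the V_k counted by c_ij.  Refining one decomposition by
    the other makes V^(s1) ⊗ V^(s2) a direct sum indexed by the rows of
    phi_C(X ⊗ Y).  The rearrangement Pi is a bijection from the positions of the
    product type to these rows that keeps the type of each row, so it
    induces an isomorphism [Theta] from V^(s1) ⊗ V^(s2) to V^(s1 ⊗ s2).
    In these coordinates the product of matrices is defined precisely so that
    Theta is natural ([Theta_nat]).

    Everything else follows from naturality.  Since the matrices of
    the structure maps of V^(m) decompose the identity, theta(m, s) is Theta
    ([theta_extE]), and the identity
      a Theta (Theta ⊗ 1) = Theta (1 ⊗ Theta) alpha
    reduces to the case of three indecomposables, where it is
    the definition of a_{i,j,l} ([assoc_basicE], [Theta_assoc]).  The unit
    constraints are identities because the rows of a product with e_1 come
    already sorted, in the order of the other factor ([Theta_unitl],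
    [Theta_unitr]).  Hence (realize, Theta) satisfies the equations of a tensor
    functor.

    That the category of block matrices satisfies the axioms of a tensor
    category is then not checked on matrices: each axiom holds after applying
    the faithful functor, where it becomes the same axiom of C
    ([pullback_tensor_category]). *)

Set Implicit Arguments.
Unset Strict Implicit.
Unset Printing Implicit Defensive.

Import GRing.Theory.
Local Open Scope ring_scope.

(** * Linear categories and functors *)

Section LinearCategory.
Variables (F : fieldType) (C : lincat F).
Implicit Types X Y Z : C.

Lemma comp_suml (J : finType) X Y Z (g : J -> hom Y Z) (f : hom X Y) :
  (\sum_j g j) \oC f = \sum_j (g j \oC f).
Proof. exact: (big_morph (fun g => g \oC f) (compDl f) (comp0l Z f)). Qed.

Lemma comp_sumr (J : finType) X Y Z (g : hom Y Z) (f : J -> hom X Y) :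
  g \oC (\sum_j f j) = \sum_j (g \oC f j).
Proof. exact: (big_morph (fun f => g \oC f) (compDr g) (comp0r X g)). Qed.

Lemma is_isoI X Y (f : hom X Y) (g : hom Y X) :
  g \oC f = idm X -> f \oC g = idm Y -> is_iso f.
Proof. by move=> gf fg; exists g. Qed.

Lemma is_iso_id X : is_iso (idm X).
Proof. by apply: (@is_isoI _ _ _ (idm X)); rewrite comp1m. Qed.

Lemma is_iso_eqhom X Y (e : X = Y) : is_iso (eqhom e).
Proof. by case: _ / e; exact: is_iso_id. Qed.

Lemma compVm X Y (f : hom X Y) : is_iso f -> invm f \oC f = idm X.
Proof. by move=> /(xgetPex 0)[]. Qed.

Lemma compmV X Y (f : hom X Y) : is_iso f -> f \oC invm f = idm Y.
Proof. by move=> /(xgetPex 0)[]. Qed.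

Lemma compVKm X Y Z (f : hom X Y) (g : hom Y Z) :
  is_iso f -> g \oC f \oC invm f = g.
Proof. by move=> fi; rewrite -compA compmV // compm1. Qed.

Lemma compKVm X Y Z (f : hom X Y) (g : hom X Z) :
  is_iso f -> g \oC invm f \oC f = g.
Proof. by move=> fi; rewrite -compA compVm // compm1. Qed.

Lemma is_iso_comp X Y Z (g : hom Y Z) (f : hom X Y) :
  is_iso g -> is_iso f -> is_iso (g \oC f).
Proof.
move=> gi fi; apply: (@is_isoI _ _ _ (invm f \oC invm g)); rewrite !compA.
  by rewrite -(compA _ (invm g)) compVm // compm1 compVm.
by rewrite compVKm // compmV.
Qed.

Lemma is_iso_invm X Y (f : hom X Y) : is_iso f -> is_iso (invm f).
Proof. by move=> fi; apply: (is_isoI (compmV fi) (compVm fi)). Qed.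

Lemma iso_epi X Y Z (f : hom X Y) (g h : hom Y Z) :
  is_iso f -> g \oC f = h \oC f -> g = h.
Proof. by move=> fi e; rewrite -(compVKm g fi) e compVKm. Qed.

Lemma isomorphic_sym X Y : isomorphic X Y -> isomorphic Y X.
Proof. by move=> [f fi]; exists (invm f); exact: is_iso_invm. Qed.

Lemma zero_idm X : idm X = 0 -> is_zero X.
Proof.
move=> X0 Y; split=> f.
  by rewrite -(compm1 f) X0 comp0r.
by rewrite -(comp1m f) X0 comp0l.
Qed.

End LinearCategory.

Section Functors.
Variables (F : fieldType) (C D : lincat F) (G : functor C D).

Lemma fmorD X Y (f g : hom X Y) : fmor G (f + g) = fmor G f + fmor G g.
Proof. by have := fmor_lin G 1 f g; rewrite !scale1r. Qed.

Lemma fmor0 X Y : fmor G (0 : hom X Y) = 0.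
Proof. by apply: (addrI (fmor G 0)); rewrite -fmorD !addr0. Qed.

Lemma fmor_sum (J : finType) X Y (f : J -> hom X Y) :
  fmor G (\sum_j f j) = \sum_j fmor G (f j).
Proof. exact: (big_morph _ (@fmorD X Y) (@fmor0 X Y)). Qed.

Lemma fmor_eqhom (X Y : C) (e : X = Y) :
  fmor G (eqhom e) = eqhom (congr1 G e).
Proof. by case: _ / e; exact: fmor_id. Qed.

Definition full := forall X Y (f : hom (G X) (G Y)), exists g, fmor G g = f.
Definition faithful := forall X Y : C, injective (@fmor _ _ _ G X Y).
Definition essentially_surjective :=
  forall Y : D, exists X : C, isomorphic (G X) Y.

Hypotheses (Gfull : full) (Gfaith : faithful).

Lemma fmor_iso_reflect (X Y : C) (f : hom X Y) : is_iso (fmor G f) -> is_iso f.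
Proof.
move=> [g [gf fg]]; have [h hg] := Gfull g; exists h; split; apply: Gfaith.
  by rewrite fmor_comp hg gf fmor_id.
by rewrite fmor_comp hg fg fmor_id.
Qed.

(** The quasi-inverse picks a preimage of each object up to isomorphism, and
    transports morphisms along the chosen isomorphisms. *)
Lemma ff_es_equivalence : essentially_surjective -> is_equivalence G.
Proof.
move=> /(@choice D C)[H0 Hiso].
pose eps Y : hom (G (H0 Y)) Y := projT1 (cid (Hiso Y)).
have epsi Y : is_iso (eps Y) := projT2 (cid (Hiso Y)).
pose lift X Y (f : hom (G X) (G Y)) := projT1 (cid (Gfull f)).
have liftK X Y (f : hom (G X) (G Y)) : fmor G (lift _ _ f) = f.
  exact: projT2 (cid (Gfull f)).
pose Hm X Y (f : hom X Y) := lift _ _ (invm (eps Y) \oC f \oC eps X).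
have Hm1 X : Hm _ _ (idm X) = idm (H0 X).
  by apply: Gfaith; rewrite liftK fmor_id compm1 compVm.
have HmM X Y Z (g : hom Y Z) (f : hom X Y) :
    Hm _ _ (g \oC f) = Hm _ _ g \oC Hm _ _ f.
  by apply: Gfaith; rewrite fmor_comp !liftK !compA compVKm.
have HmL X Y a (f g : hom X Y) :
    Hm _ _ (a *: f + g) = a *: Hm _ _ f + Hm _ _ g.
  by apply: Gfaith; rewrite fmor_lin !liftK comp_linr comp_linl.
exists (Functor Hm1 HmM HmL); split.
  exists (fun X => lift _ _ (eps (G X))); split=> [X|X Y f].
    by apply: fmor_iso_reflect; rewrite liftK; exact: epsi.
  apply: Gfaith; rewrite !fmor_comp !liftK /= !compA.
  by rewrite compmV ?comp1m.
exists eps; split=> // X Y f /=.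
by rewrite liftK !compA compmV ?comp1m.
Qed.

End Functors.

(** * Direct sums *)

Section DirectSums.
Variables (F : fieldType) (C : lincat F).

Section OneSum.
Variables (J : finType) (X : J -> C) (S : C) (d : dsum X S).

Lemma dsum_ext_pr Z (f g : hom Z S) :
  (forall j, dpr d j \oC f = dpr d j \oC g) -> f = g.
Proof.
move=> e; rewrite -(comp1m f) -(comp1m g) -(dsum_id d) !comp_suml.
by apply: eq_bigr => j _; rewrite -!compA e.
Qed.

Lemma dsum_ext_inj Z (f g : hom S Z) :
  (forall j, f \oC dinj d j = g \oC dinj d j) -> f = g.
Proof.
move=> e; rewrite -(compm1 f) -(compm1 g) -(dsum_id d) !comp_sumr.
by apply: eq_bigr => j _; rewrite !compA e.
Qed.

Lemma dsum_reindex_id (K : finType) (h : K -> J) : bijective h ->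
  \sum_k (dinj d (h k) \oC dpr d (h k)) = idm S.
Proof.
move=> hb; rewrite -(dsum_id d) [RHS](reindex h) //; exact: onW_bij.
Qed.

Definition dsum_reindex (K : finType) (h : K -> J) (hb : bijective h) :
  dsum (fun k => X (h k)) S :=
  @Dsum _ _ _ (fun k => X (h k)) S (fun k => dpr d (h k)) (fun k => dinj d (h k))
    (fun k => dpr_inj d (h k))
    (fun k l kl => dpr_inj0 d (contra_neq (bij_inj hb (x2 := l)) kl))
    (dsum_reindex_id hb).

Section Transport.
Variables (S' : C) (f : hom S' S) (fi : is_iso f).

Lemma dsum_iso_id :
  \sum_j ((invm f \oC dinj d j) \oC (dpr d j \oC f)) = idm S'.
Proof.
rewrite -(compVm fi) -[X in _ = _ \oC X]comp1m -(dsum_id d).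
rewrite comp_suml comp_sumr; apply: eq_bigr => j _; by rewrite !compA.
Qed.

Lemma dsum_iso_pr_inj j k :
  (dpr d j \oC f) \oC (invm f \oC dinj d k) = dpr d j \oC dinj d k.
Proof. by rewrite !compA compVKm. Qed.

Definition dsum_iso : dsum X S' :=
  @Dsum _ _ _ X S' (fun j => dpr d j \oC f) (fun j => invm f \oC dinj d j)
    (fun j => etrans (dsum_iso_pr_inj j j) (dpr_inj d j))
    (fun j k jk => etrans (dsum_iso_pr_inj j k) (dpr_inj0 d jk))
    dsum_iso_id.

End Transport.

Section Refine.
Variables (K : J -> finType) (Y : forall j, K j -> C).
Variable e : forall j, dsum (@Y j) (X j).
Implicit Types u v : {j & K j}.

Let rpr u := dpr (e (tag u)) (tagged u) \oC dpr d (tag u).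
Let rinj u := dinj d (tag u) \oC dinj (e (tag u)) (tagged u).

Lemma dsum_sigma_pr_inj u : rpr u \oC rinj u = idm (Y (tagged u)).
Proof.
by rewrite /rpr /rinj !compA -(compA _ (dpr d _)) dpr_inj compm1 dpr_inj.
Qed.

Lemma dsum_sigma_pr_inj0 u v : u != v -> rpr u \oC rinj v = 0.
Proof.
case: u v => [j a] [k b]; rewrite /rpr /rinj /= => uv.
rewrite !compA -(compA _ (dpr d _)).
have [ejk|jk] := eqVneq j k; last by rewrite (dpr_inj0 d jk) comp0r comp0l.
case: _ / ejk b uv => b; rewrite -tag_eqE /tag_eq eqxx /= tagged_asE => ab.
by rewrite dpr_inj compm1 dpr_inj0.
Qed.

Lemma dsum_sigma_id : \sum_u (rinj u \oC rpr u) = idm S.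
Proof.
rewrite /rpr /rinj -(dsum_id d).
transitivity (\sum_j \sum_(a : K j)
  (dinj d j \oC dinj (e j) a \oC (dpr (e j) a \oC dpr d j))).
  by rewrite sig_big_dep.
apply: eq_bigr => j _.
rewrite -[X in _ = X \oC _]compm1 -(dsum_id (e j)) comp_sumr comp_suml.
by apply: eq_bigr => a _; rewrite !compA.
Qed.

(** Decomposing each summand of a decomposition gives a finer decomposition;
    applied below to V^(s1) ⊗ V^(s2) = sum of the V_i ⊗ V_j. *)
Definition dsum_sigma : dsum (fun u : {j & K j} => Y (tagged u)) S :=
  @Dsum _ _ _ (fun u : {j & K j} => Y (tagged u)) S rpr rinj
    dsum_sigma_pr_inj dsum_sigma_pr_inj0 dsum_sigma_id.

End Refine.
End OneSum.

Section Compare.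
Variables (J J' : finType) (X : J -> C) (X' : J' -> C) (S S' : C).
Variables (d : dsum X S) (d' : dsum X' S').
Variables (h : J -> J') (f : forall j, hom (X' (h j)) (X j)).

Definition dsum_map : hom S' S :=
  \sum_j (dinj d j \oC f j \oC dpr d' (h j)).

Lemma dpr_dsum_map j : dpr d j \oC dsum_map = f j \oC dpr d' (h j).
Proof.
rewrite comp_sumr (bigD1 j) //= !compA dpr_inj comp1m big1 ?addr0 // => k kj.
by rewrite !compA dpr_inj0 ?comp0l // eq_sym.
Qed.

Hypotheses (hb : bijective h) (fi : forall j, is_iso (f j)).

Lemma dsum_map_inj j : dsum_map \oC dinj d' (h j) = dinj d j \oC f j.
Proof.
rewrite comp_suml (bigD1 j) //= -!compA dpr_inj compm1 big1 ?addr0 // => k kj.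
rewrite -!compA dpr_inj0 ?comp0r //.
by apply: contra_neq kj; exact: (bij_inj hb).
Qed.

Lemma dsum_map_iso : is_iso dsum_map.
Proof.
pose g : hom S S' := \sum_j (dinj d' (h j) \oC invm (f j) \oC dpr d j).
apply: (@is_isoI _ _ _ _ _ g).
  rewrite comp_suml -(dsum_reindex_id d' hb); apply: eq_bigr => j _.
  by rewrite -compA dpr_dsum_map compA compKVm.
rewrite comp_sumr -(dsum_id d); apply: eq_bigr => j _.
by rewrite !compA dsum_map_inj compVKm.
Qed.

End Compare.
End DirectSums.

(** * Tensor categories *)

(** Composites are kept associated to the left, so that an equation between
    composites of two or three factors is usable inside a longer composite only
    with an arbitrary morphism [k] in front of it. *)
Lemma comp_reassoc (F : fieldType) (C : lincat F) (X Y Z : C)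
    (g : hom Y Z) (f : hom X Y) (h : hom X Z) :
  g \oC f = h -> forall W (k : hom Z W), k \oC g \oC f = k \oC h.
Proof. by move=> <- W k; rewrite compA. Qed.

Lemma comp_reassoc3 (F : fieldType) (C : lincat F) (W X Y Z : C)
    (g : hom Y Z) (f : hom X Y) (e : hom W X) (h : hom W Z) :
  g \oC f \oC e = h ->
  forall Z' (k : hom Z Z'), k \oC g \oC f \oC e = k \oC h.
Proof. by move=> <- Z' k; rewrite !compA. Qed.

Lemma is_iso_cancelr (F : fieldType) (C : lincat F) (X Y Z : C)
    (g : hom Y Z) (f : hom X Y) : is_iso f -> is_iso (g \oC f) -> is_iso g.
Proof.
move=> fi gfi; rewrite -(compVKm g fi).
exact: is_iso_comp gfi (is_iso_invm fi).
Qed.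

Section Tensor.
Variables (F : fieldType) (C : lincat F) (T : tensor_data C).
Hypothesis hT : is_tensor_category T.

Local Notation "X '⊗' Y" := (tens T X Y) (at level 38, left associativity).
Local Notation "f '⊠' g" := (tensm T f g) (at level 38, left associativity).

Lemma tensDl (X X' Y Y' : C) (g : hom Y Y') (f f' : hom X X') :
  (f + f') ⊠ g = f ⊠ g + f' ⊠ g.
Proof. by have := tens_linl hT g 1 f f'; rewrite !scale1r. Qed.

Lemma tensDr (X X' Y Y' : C) (f : hom X X') (g g' : hom Y Y') :
  f ⊠ (g + g') = f ⊠ g + f ⊠ g'.
Proof. by have := tens_linr hT f 1 g g'; rewrite !scale1r. Qed.

Lemma tens0l (X X' Y Y' : C) (g : hom Y Y') : (0 : hom X X') ⊠ g = 0.
Proof. by apply: (addrI ((0 : hom X X') ⊠ g)); rewrite -tensDl !addr0. Qed.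

Lemma tens0r (X X' Y Y' : C) (f : hom X X') : f ⊠ (0 : hom Y Y') = 0.
Proof. by apply: (addrI (f ⊠ (0 : hom Y Y'))); rewrite -tensDr !addr0. Qed.

Lemma tens_suml (J : finType) (X X' Y Y' : C) (f : J -> hom X X')
    (g : hom Y Y') : (\sum_j f j) ⊠ g = \sum_j (f j ⊠ g).
Proof. exact: (big_morph (fun f => f ⊠ g) (tensDl g) (tens0l X X' g)). Qed.

Lemma tens_sumr (J : finType) (X X' Y Y' : C) (f : hom X X')
    (g : J -> hom Y Y') : f ⊠ (\sum_j g j) = \sum_j (f ⊠ g j).
Proof. exact: (big_morph (fun g => f ⊠ g) (tensDr f) (tens0r Y Y' f)). Qed.

Lemma tens_iso (X X' Y Y' : C) (f : hom X X') (g : hom Y Y') :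
  is_iso f -> is_iso g -> is_iso (f ⊠ g).
Proof.
move=> fi gi; apply: (@is_isoI _ _ _ _ _ (invm f ⊠ invm g)).
  by rewrite -tens_comp // !compVm // tens_id.
by rewrite -tens_comp // !compmV // tens_id.
Qed.

Lemma tens_comp1r (X X' X'' Y : C) (f' : hom X' X'') (f : hom X X') :
  (f' ⊠ idm Y) \oC (f ⊠ idm Y) = (f' \oC f) ⊠ idm Y.
Proof. by rewrite -tens_comp // comp1m. Qed.

Lemma tens_comp1l (X Y Y' Y'' : C) (g' : hom Y' Y'') (g : hom Y Y') :
  (idm X ⊠ g') \oC (idm X ⊠ g) = idm X ⊠ (g' \oC g).
Proof. by rewrite -tens_comp // comp1m. Qed.

Lemma tens_swap (X X' Y Y' : C) (f : hom X X') (g : hom Y Y') :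
  (f ⊠ idm Y') \oC (idm X ⊠ g) = (idm X' ⊠ g) \oC (f ⊠ idm Y).
Proof. by rewrite -!tens_comp // !comp1m !compm1. Qed.

Section TensorSum.
Variables (J K : finType) (X : J -> C) (Y : K -> C) (S R : C).
Variables (d : dsum X S) (e : dsum Y R).

Let tpr (z : K * J) := dpr d z.2 ⊠ dpr e z.1.
Let tinj (z : K * J) := dinj d z.2 ⊠ dinj e z.1.

Lemma tens_dsum_pr_inj z : tpr z \oC tinj z = idm (X z.2 ⊗ Y z.1).
Proof. by rewrite -tens_comp // !dpr_inj tens_id. Qed.

Lemma tens_dsum_pr_inj0 z w : z != w -> tpr z \oC tinj w = 0.
Proof.
case: z w => [k j] [k' j']; rewrite xpair_eqE negb_and -tens_comp //=.
by case/orP=> /dpr_inj0 ->; rewrite ?tens0l ?tens0r.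
Qed.

Lemma tens_dsum_id : \sum_z (tinj z \oC tpr z) = idm (S ⊗ R).
Proof.
rewrite -tens_id // -(dsum_id e) -(dsum_id d) tens_sumr.
under [RHS]eq_bigr do rewrite tens_suml.
by rewrite pair_bigA; apply: eq_bigr => z _; rewrite tens_comp.
Qed.

(** The right factor comes first in the index, in agreement with the order of
    the rows of a product of matrices. *)
Definition tens_dsum : dsum (fun z : K * J => X z.2 ⊗ Y z.1) (S ⊗ R) :=
  @Dsum _ _ _ (fun z : K * J => X z.2 ⊗ Y z.1) _ tpr tinj
    tens_dsum_pr_inj tens_dsum_pr_inj0 tens_dsum_id.

End TensorSum.
End Tensor.

(** A [tensor_functor] presupposes no axiom on its source.  When it is fully
    faithful and its target is a tensor category, an equation in the source may
    be tested on its image, composed with the isomorphisms phi_2 and phi_0; the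
    compatibilities of phi_2 and phi_0 turn that image into the same equation
    of the target, and fullness provides the inverses of the constraints. *)
Section Pullback.
Variables (F : fieldType) (C D : lincat F).
Variables (TD : tensor_data D) (TC : tensor_data C).
Variable G : tensor_functor TD TC.
Hypotheses (hT : is_tensor_category TC) (Gfull : full G) (Gfaith : faithful G).

Local Notation "f '⊠' g" := (tensm TC f g) (at level 38, left associativity).
Local Notation "f '⊡' g" := (tensm TD f g) (at level 38, left associativity).
Local Notation phi := (tphi2 G).
Local Notation phi0 := (tphi0 G).

Let phi_i X Y : is_iso (phi X Y) := tphi2_iso G X Y.
Let phi0_i : is_iso phi0 := tphi0_iso G.

Lemma fmor_tens X X' Y Y' (f : hom X X') (g : hom Y Y') :
  fmor G (f ⊡ g) = phi X' Y' \oC (fmor G f ⊠ fmor G g) \oC invm (phi X Y).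
Proof. by rewrite tphi2_nat compVKm. Qed.

Let tens1_i X Y Z (f : hom X Y) : is_iso f -> is_iso (f ⊠ idm Z).
Proof. by move=> fi; apply: tens_iso => //; exact: is_iso_id. Qed.

Let tens_1i X Y Z (f : hom X Y) : is_iso f -> is_iso (idm Z ⊠ f).
Proof. by move=> fi; apply: tens_iso => //; exact: is_iso_id. Qed.

Let phi3_i X Y Z :
  is_iso (phi (tens TD X Y) Z \oC (phi X Y ⊠ idm (G Z))).
Proof. by apply: is_iso_comp => //; exact: tens1_i. Qed.

Lemma pullback_assoc_iso X Y Z : is_iso (tassoc TD X Y Z).
Proof.
apply: (fmor_iso_reflect Gfull Gfaith); apply: is_iso_cancelr (phi3_i X Y Z) _.
rewrite compA tfun_assoc; apply: is_iso_comp (tassoc_iso hT _ _ _).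
by apply: is_iso_comp => //; exact: tens_1i.
Qed.

Lemma pullback_assoc_nat X X' Y Y' Z Z'
    (f : hom X X') (g : hom Y Y') (h : hom Z Z') :
  tassoc TD X' Y' Z' \oC ((f ⊡ g) ⊡ h) = (f ⊡ (g ⊡ h)) \oC tassoc TD X Y Z.
Proof.
have natl : (fmor G (f ⊡ g) ⊠ fmor G h) \oC (phi X Y ⊠ idm (G Z)) =
    (phi X' Y' ⊠ idm (G Z')) \oC ((fmor G f ⊠ fmor G g) ⊠ fmor G h).
  by rewrite -!(tens_comp hT) -tphi2_nat comp1m compm1.
have natr : (fmor G f ⊠ fmor G (g ⊡ h)) \oC (idm (G X) ⊠ phi Y Z) =
    (idm (G X') ⊠ phi Y' Z') \oC (fmor G f ⊠ (fmor G g ⊠ fmor G h)).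
  by rewrite -!(tens_comp hT) -tphi2_nat comp1m compm1.
apply: Gfaith; apply: iso_epi (phi3_i X Y Z) _; rewrite !fmor_comp !compA.
rewrite (comp_reassoc (esym (tphi2_nat G (f ⊡ g) h))) !compA.
rewrite (comp_reassoc natl) !compA tfun_assoc.
rewrite (comp_reassoc (tassoc_nat hT _ _ _)) !compA.
rewrite (comp_reassoc3 (tfun_assoc G X Y Z)) !compA.
by rewrite -(tphi2_nat G f (g ⊡ h)) (comp_reassoc natr) !compA.
Qed.

(** Both sides, preceded by phi_2 (phi_2 ⊗ 1) ((phi_2 ⊗ 1) ⊗ 1), are moved past
    all the phi_2 until only the two sides of the pentagon of the target
    remain. *)
Lemma pullback_pentagon W X Y Z :
  tassoc TD W X (tens TD Y Z) \oC tassoc TD (tens TD W X) Y Z =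
  (idm W ⊡ tassoc TD X Y Z) \oC tassoc TD W (tens TD X Y) Z
    \oC (tassoc TD W X Y ⊡ idm Z).
Proof.
have phi4_i : is_iso (phi (tens TD (tens TD W X) Y) Z
    \oC (phi (tens TD W X) Y ⊠ idm (G Z))
    \oC ((phi W X ⊠ idm (G Y)) ⊠ idm (G Z))).
  by apply: is_iso_comp => //; do !apply: tens1_i.
apply: Gfaith; apply: iso_epi phi4_i _; rewrite !fmor_comp !compA.
have natl : tassoc TC (G (tens TD W X)) (G Y) (G Z)
      \oC ((phi W X ⊠ idm (G Y)) ⊠ idm (G Z)) =
    (phi W X ⊠ idm (tens TC (G Y) (G Z)))
      \oC tassoc TC (tens TC (G W) (G X)) (G Y) (G Z).
  by rewrite tassoc_nat // tens_id.
have natr : tassoc TC (G W) (G X) (G (tens TD Y Z))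
      \oC (idm (tens TC (G W) (G X)) ⊠ phi Y Z) =
    (idm (G W) ⊠ (idm (G X) ⊠ phi Y Z))
      \oC tassoc TC (G W) (G X) (tens TC (G Y) (G Z)).
  by rewrite -(tens_id hT) tassoc_nat.
have natm : tassoc TC (G W) (G (tens TD X Y)) (G Z)
      \oC ((idm (G W) ⊠ phi X Y) ⊠ idm (G Z)) =
    (idm (G W) ⊠ (phi X Y ⊠ idm (G Z)))
      \oC tassoc TC (G W) (tens TC (G X) (G Y)) (G Z).
  by rewrite tassoc_nat.
rewrite (comp_reassoc3 (tfun_assoc G (tens TD W X) Y Z)) !compA.
rewrite (comp_reassoc natl) !compA.
rewrite (comp_reassoc (esym (tens_swap hT (phi W X) (phi Y Z)))) !compA.
rewrite tfun_assoc (comp_reassoc natr) !compA.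
have tassoc1 : (fmor G (tassoc TD W X Y) ⊠ fmor G (idm Z))
      \oC (phi (tens TD W X) Y ⊠ idm (G Z))
      \oC ((phi W X ⊠ idm (G Y)) ⊠ idm (G Z)) =
    (phi W (tens TD X Y) ⊠ idm (G Z))
      \oC ((idm (G W) ⊠ phi X Y) ⊠ idm (G Z))
      \oC (tassoc TC (G W) (G X) (G Y) ⊠ idm (G Z)).
  by rewrite fmor_id !tens_comp1r // tfun_assoc.
have tassoc2 : (fmor G (idm W) ⊠ fmor G (tassoc TD X Y Z))
      \oC (idm (G W) ⊠ phi (tens TD X Y) Z)
      \oC (idm (G W) ⊠ (phi X Y ⊠ idm (G Z))) =
    (idm (G W) ⊠ phi X (tens TD Y Z))
      \oC (idm (G W) ⊠ (idm (G X) ⊠ phi Y Z))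
      \oC (idm (G W) ⊠ tassoc TC (G X) (G Y) (G Z)).
  by rewrite fmor_id !tens_comp1l // tfun_assoc.
rewrite (comp_reassoc (esym (tphi2_nat G (tassoc TD W X Y) (idm Z)))) !compA.
rewrite (comp_reassoc3 tassoc1) !compA.
rewrite (comp_reassoc3 (tfun_assoc G W (tens TD X Y) Z)) !compA.
rewrite (comp_reassoc natm) !compA.
rewrite -(tphi2_nat G (idm W)) (comp_reassoc3 tassoc2) !compA.
by rewrite (comp_reassoc (tpentagon hT _ _ _ _)) !compA.
Qed.

Lemma pullback_triangle X Y :
  (idm X ⊡ tlunit TD Y) \oC tassoc TD X (tunit TD) Y = trunit TD X ⊡ idm Y.
Proof.
have phi3u_i : is_iso (phi (tens TD X (tunit TD)) Y
    \oC (phi X (tunit TD) ⊠ idm (G Y)) \oC ((idm (G X) ⊠ phi0) ⊠ idm (G Y))).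
  by apply: is_iso_comp => //; apply: tens1_i; exact: tens_1i.
apply: Gfaith; apply: iso_epi phi3u_i _; rewrite !fmor_comp !compA.
rewrite (comp_reassoc3 (tfun_assoc G X (tunit TD) Y)) !compA.
rewrite (comp_reassoc (tassoc_nat hT _ _ _)) !compA.
rewrite -!(tphi2_nat G) !fmor_id.
have unitl : (idm (G X) ⊠ fmor G (tlunit TD Y))
      \oC (idm (G X) ⊠ phi (tunit TD) Y) \oC (idm (G X) ⊠ (phi0 ⊠ idm (G Y))) =
    idm (G X) ⊠ tlunit TC (G Y).
  by rewrite !tens_comp1l // tfun_lunit.
have unitr : (fmor G (trunit TD X) ⊠ idm (G Y))
      \oC (phi X (tunit TD) ⊠ idm (G Y)) \oC ((idm (G X) ⊠ phi0) ⊠ idm (G Y)) =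
    trunit TC (G X) ⊠ idm (G Y).
  by rewrite !tens_comp1r // tfun_runit.
rewrite (comp_reassoc3 unitl) (comp_reassoc3 unitr) -(ttriangle hT).
by rewrite compA.
Qed.

Lemma pullback_lunit_iso X : is_iso (tlunit TD X).
Proof.
apply: (fmor_iso_reflect Gfull Gfaith).
apply: (is_iso_cancelr (f := phi (tunit TD) X \oC (phi0 ⊠ idm (G X)))).
  by apply: is_iso_comp => //; exact: tens1_i.
by rewrite compA tfun_lunit; exact: tlunit_iso hT _.
Qed.

Lemma pullback_runit_iso X : is_iso (trunit TD X).
Proof.
apply: (fmor_iso_reflect Gfull Gfaith).
apply: (is_iso_cancelr (f := phi X (tunit TD) \oC (idm (G X) ⊠ phi0))).
  by apply: is_iso_comp => //; exact: tens_1i.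
by rewrite compA tfun_runit; exact: trunit_iso hT _.
Qed.

Lemma pullback_lunit_nat X X' (f : hom X X') :
  tlunit TD X' \oC (idm (tunit TD) ⊡ f) = f \oC tlunit TD X.
Proof.
have phiu_i : is_iso (phi (tunit TD) X \oC (phi0 ⊠ idm (G X))).
  by apply: is_iso_comp => //; exact: tens1_i.
apply: Gfaith; apply: iso_epi phiu_i _; rewrite !fmor_comp !compA.
rewrite (comp_reassoc (esym (tphi2_nat G _ f))) fmor_id !compA.
rewrite (comp_reassoc (esym (tens_swap hT phi0 (fmor G f)))) !compA.
rewrite tfun_lunit (comp_reassoc3 (tfun_lunit G X)).
exact: tlunit_nat hT _ _ _.
Qed.

Lemma pullback_runit_nat X X' (f : hom X X') :
  trunit TD X' \oC (f ⊡ idm (tunit TD)) = f \oC trunit TD X.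
Proof.
have phiu_i : is_iso (phi X (tunit TD) \oC (idm (G X) ⊠ phi0)).
  by apply: is_iso_comp => //; exact: tens_1i.
apply: Gfaith; apply: iso_epi phiu_i _; rewrite !fmor_comp !compA.
rewrite (comp_reassoc (esym (tphi2_nat G f _))) fmor_id !compA.
rewrite (comp_reassoc (tens_swap hT (fmor G f) phi0)) !compA.
rewrite tfun_runit (comp_reassoc3 (tfun_runit G X)).
exact: trunit_nat hT _ _ _.
Qed.

Lemma pullback_tensor_category : is_tensor_category TD.
Proof.
split.
- move=> X Y; apply: Gfaith.
  by rewrite fmor_tens !fmor_id tens_id // compm1 compmV.
- move=> X X' X'' Y Y' Y'' f' f g' g; apply: Gfaith.
  rewrite fmor_comp !fmor_tens !fmor_comp tens_comp // !compA.
  by rewrite compKVm.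
- move=> X X' Y Y' g a f f'; apply: Gfaith.
  by rewrite fmor_lin !fmor_tens fmor_lin tens_linl // comp_linr comp_linl.
- move=> X X' Y Y' f a g g'; apply: Gfaith.
  by rewrite fmor_lin !fmor_tens fmor_lin tens_linr // comp_linr comp_linl.
- exact: pullback_assoc_iso.
- exact: pullback_assoc_nat.
- exact: pullback_lunit_iso.
- exact: pullback_lunit_nat.
- exact: pullback_runit_iso.
- exact: pullback_runit_nat.
- exact: pullback_pentagon.
- exact: pullback_triangle.
Qed.

End Pullback.

(** * Block matrices as morphisms *)

Section Matrices.
Variables (F : fieldType) (C : lincat F) (T : tensor_data C) (D : frame T).

Local Notation I := 'I_(fr_n D).+1.
Local Notation NI := {ffun I -> nat}.
Local Notation V := (fr_V D).
Local Notation Vm := (fr_Vm D).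
Local Notation pos m := 'I_(\sum_i fun_of_fin m i)%N.
Local Notation blk p := (tagnat.sig1 p).

(** The identity when i = j, zero otherwise.  It identifies V_i with V_j along a
    propositional equality of indices without transporting along the
    equality proof; such equalities appear because the type of a row
    of a product is only provably the block of its position. *)
Definition cast (i j : I) : hom (V i) (V j) :=
  dpr (fr_sumP D) j \oC dinj (fr_sumP D) i.

Lemma cast_id i : cast i i = idm (V i). Proof. exact: dpr_inj. Qed.

Lemma cast_iso i j : i = j -> is_iso (cast i j).
Proof. by move=> ->; rewrite cast_id; exact: is_iso_id. Qed.

Lemma cast_trans i j k : i = j -> cast j k \oC cast i j = cast i k.
Proof. by move=> ->; rewrite cast_id compm1. Qed.

Lemma castK i j : i = j -> cast j i \oC cast i j = idm (V i).
Proof. by move=> e; rewrite cast_trans // cast_id. Qed.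

Lemma auslander_mulE (x y : auslander D) : x * y = x \oC y. Proof. by []. Qed.

Lemma of_to_alg i j k l (f : hom (V i) (V j)) :
  of_alg k l (to_alg f) = cast j l \oC f \oC cast k i.
Proof. by rewrite /of_alg /to_alg /cast !compA. Qed.

Lemma to_of_alg i j (x : auslander D) :
  to_alg (of_alg i j x) = idem j * x * idem i.
Proof. by rewrite /of_alg /to_alg /idem !auslander_mulE !compA. Qed.

Lemma of_algD i j (x y : auslander D) :
  of_alg i j (x + y) = of_alg i j x + of_alg i j y.
Proof. by rewrite /of_alg compDr compDl. Qed.

Lemma of_alg0 i j : of_alg i j (0 : auslander D) = 0.
Proof. by rewrite /of_alg comp0r comp0l. Qed.

Lemma of_algZ i j a (x : auslander D) : of_alg i j (a *: x) = a *: of_alg i j x.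
Proof. by rewrite /of_alg compZr compZl. Qed.

Lemma of_alg_sum (J : finType) i j (x : J -> auslander D) :
  of_alg i j (\sum_k x k) = \sum_k of_alg i j (x k).
Proof. exact: (big_morph _ (@of_algD i j) (@of_alg0 i j)). Qed.

Lemma of_alg_idem i : of_alg i i (idem i) = idm (V i).
Proof. by rewrite /of_alg /idem !compA dpr_inj comp1m dpr_inj. Qed.

(** The hypothesis is needed because [of_alg] only reads off one component: the
    product of components through V_j is the full component of [x * y] when
    [x] is supported on V_j. *)
Lemma of_alg_mul i j k (x y : auslander D) : x * idem j = x ->
  of_alg i k (x * y) = of_alg j k x \oC of_alg i j y.
Proof. by move=> {1}<-; rewrite /of_alg /idem !auslander_mulE !compA. Qed.

Lemma blockmx_idl s m (X : blockmx (D := D) s m) p q :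
  idem (blk p) * X p q = X p q.
Proof.
have /is_blockP hX := blockmxP X.
by rewrite -[in LHS]hX !mulrA idem_id hX.
Qed.

Lemma blockmx_idr s m (X : blockmx (D := D) s m) p q :
  X p q * idem (blk q) = X p q.
Proof.
have /is_blockP hX := blockmxP X.
by rewrite -[in LHS]hX -!mulrA idem_id !mulrA hX.
Qed.

Definition pos_dsum (m : NI) : dsum (fun p : pos m => V (blk p)) (Vm m) :=
  dsum_reindex (fr_VmP D m) tagnat.sig_bij.

Lemma projE m (p : pos m) : proj p = dpr (pos_dsum m) p. Proof. by []. Qed.

Lemma proj_emb m (p : pos m) : proj p \oC emb p = idm (V (blk p)).
Proof. exact: (dpr_inj (pos_dsum m)). Qed.

Lemma proj_emb0 m (p q : pos m) : p != q -> proj p \oC emb (D := D) q = 0.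
Proof. exact: (dpr_inj0 (pos_dsum m)). Qed.

Lemma hom_ext_pos m s (f g : hom (Vm m) (Vm s)) :
  (forall p q, proj p \oC f \oC emb q = proj p \oC g \oC emb q) -> f = g.
Proof.
move=> e; apply: (dsum_ext_pr (d := pos_dsum s)) => p.
by apply: (dsum_ext_inj (d := pos_dsum m)) => q; exact: e.
Qed.

Lemma proj_of_mx s m (X : blockmx (D := D) s m) p :
  proj p \oC of_mx X = \sum_q (of_alg (blk q) (blk p) (X p q) \oC proj q).
Proof.
rewrite comp_sumr (bigD1 p) //= [X in _ + X]big1 ?addr0 => [|k kp].
  by rewrite comp_sumr; apply: eq_bigr => q _; rewrite !compA proj_emb comp1m.
rewrite comp_sumr big1 // => q _.
by rewrite !compA proj_emb0 ?comp0l // eq_sym.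
Qed.

Lemma proj_of_mx_emb s m (X : blockmx (D := D) s m) p q :
  proj p \oC of_mx X \oC emb q = of_alg (blk q) (blk p) (X p q).
Proof.
rewrite proj_of_mx comp_suml (bigD1 q) //= -compA proj_emb compm1.
by rewrite [X in _ + X]big1 ?addr0 // => k kq; rewrite -compA proj_emb0 ?comp0r.
Qed.

Lemma to_mxK m s (f : hom (Vm m) (Vm s)) : of_mx (to_mx f) = f.
Proof.
apply: hom_ext_pos => p q; rewrite proj_of_mx_emb mxE of_to_alg.
by rewrite !cast_id comp1m compm1.
Qed.

Lemma of_mxK s m (X : blockmx (D := D) s m) : to_mx (of_mx X) = X.
Proof.
apply: blockmx_eq => p q; rewrite mxE proj_of_mx_emb to_of_alg.
by rewrite blockmx_idl blockmx_idr.
Qed.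

Lemma of_mx1 m : of_mx (blockmx_id (D := D) m) = idm (Vm m).
Proof.
apply: hom_ext_pos => p q; rewrite proj_of_mx_emb compm1 mxE.
case: eqP => [<-|/eqP pq]; first by rewrite proj_emb of_alg_idem.
by rewrite proj_emb0 // of_alg0.
Qed.

Lemma of_mxM r s m (X : blockmx (D := D) r s) (Y : blockmx s m) :
  of_mx (blockmx_mul X Y) = of_mx X \oC of_mx Y.
Proof.
apply: hom_ext_pos => p q; rewrite proj_of_mx_emb blockmx_mulE of_alg_sum.
rewrite compA proj_of_mx !comp_suml; apply: eq_bigr => k _.
rewrite (of_alg_mul _ _ _ (blockmx_idr X p k)) -!compA (compA (proj k)).
by rewrite proj_of_mx_emb.
Qed.

Lemma of_mx_lin s m a (X Y : blockmx (D := D) s m) :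
  of_mx (a *: X + Y) = a *: of_mx X + of_mx Y.
Proof.
apply: hom_ext_pos => p q; rewrite comp_linr comp_linl !proj_of_mx_emb.
by rewrite blockmx_lin of_algD of_algZ.
Qed.

Definition realize : functor (hat_cat D) C :=
  @Functor F (hat_cat D) C Vm (fun m s X => of_mx X) of_mx1
    (fun _ _ _ X Y => of_mxM X Y) (fun _ _ => @of_mx_lin _ _).

Lemma realize_full : full realize.
Proof. by move=> m s f; exists (to_mx f); exact: to_mxK. Qed.

Lemma realize_faithful : faithful realize.
Proof. by move=> m s X Y /(congr1 (@to_mx _ _ _ D m s)); rewrite !of_mxK. Qed.

End Matrices.

(** * Every object is a sum of copies of the chosen indecomposables *)

(** In X = Y + Z the two idempotents add up to the identity, so one of them is
    invertible by locality, and it annihilates the other summand. *)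
Lemma local_end_indecomposable (F : fieldType) (C : lincat F) (X : C) :
  local_end X -> indecomposable X.
Proof.
move=> [X0 loc]; split=> [zX|Y Z d]; first by apply: X0; apply: (zX X).1.
have other b :
    is_iso (dinj d b \oC dpr d b) -> is_zero (pair_family Y Z (~~ b)).
  move=> bi; apply: zero_idm; rewrite -(dpr_inj d).
  suff -> : dpr d (~~ b) = 0 by rewrite comp0l.
  by apply: iso_epi bi _; rewrite comp0l compA dpr_inj0 ?comp0l //; case: (b).
have := dsum_id d; rewrite big_bool /= => e.
have /loc[/other|/other] : is_iso (dinj d true \oC dpr d true
    + dinj d false \oC dpr d false) by rewrite e; exact: is_iso_id.
  by right.
by left.
Qed.

Section Fibers.
Variables (n k : nat) (f : 'I_k -> 'I_n).

Definition fiber (i : 'I_n) : seq 'I_k := [seq j <- enum 'I_k | f j == i].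

Lemma mem_fiber j i : (j \in fiber i) = (f j == i).
Proof. by rewrite mem_filter mem_enum andbT. Qed.

Definition fiber_size : {ffun 'I_n -> nat} := [ffun i => size (fiber i)].

Lemma fiber_index_lt j : (index j (fiber (f j)) < fiber_size (f j))%N.
Proof. by rewrite ffunE index_mem mem_fiber. Qed.

(** An object decomposed into indecomposables Y_j with Y_j isomorphic to V_(f j)
    is V^(m) for m the sizes of the fibers of f; numbering each fiber matches
    the summand Y_j with one copy of V_(f j). *)
Definition fiber_index (j : 'I_k) : {i : 'I_n & 'I_(fiber_size i)} :=
  Tagged (fun i => 'I_(fiber_size i)) (Ordinal (fiber_index_lt j)).

Lemma fiber_index_bij : bijective fiber_index.
Proof.
apply: inj_card_bij => [j j' e|].
  have ef : f j = f j' by exact: (congr1 tag e).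
  have /= := congr1
    (fun z : {i : 'I_n & 'I_(fiber_size i)} => val (tagged z)) e.
  by rewrite ef; apply: (index_inj j); rewrite mem_fiber ?ef.
rewrite [leqLHS](card_tagged (fun i => 'I_(fiber_size i))).
rewrite sumnE big_map big_enum /=.
rewrite -sum1_card (partition_big f xpredT) //=.
apply: leq_sum => i _; rewrite card_ord ffunE -sum1_size big_filter.
by rewrite big_enum_cond.
Qed.

End Fibers.

Lemma realize_essentially_surjective (F : fieldType) (C : lincat F)
    (T : tensor_data C) (D : frame T) :
  krull_schmidt C -> essentially_surjective (realize D).
Proof.
move=> ks X; have [k [Y [[d] loc]]] := ks X.
have /choice[f fP] : forall j, exists i, isomorphic (fr_V D i) (Y j).
  move=> j; have [i ij] := fr_V_all D (local_end_indecomposable (loc j)).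
  by exists i; exact: isomorphic_sym.
pose g j := projT1 (cid (fP j)).
exists (fiber_size f); exists (dsum_map d (fr_VmP D _) (h := fiber_index f) g).
by apply: dsum_map_iso (fiber_index_bij f) (fun j => projT2 (cid (fP j))).
Qed.

(** * The comparison isomorphism Theta *)

Section Theta.
Variables (F : fieldType) (C : lincat F) (T : tensor_data C) (D : frame T).
Hypothesis hT : is_tensor_category T.

Local Notation V := (fr_V D).
Local Notation Vm := (fr_Vm D).
Local Notation c := (fr_c D).
Local Notation theta := (fr_theta D).
Local Notation pos m := 'I_(\sum_i fun_of_fin m i)%N.
Local Notation blk p := (tagnat.sig1 p).
Local Notation hat_ob := (hat_ob (D := D)).
Local Notation prerow := (prerow (D := D)).
Local Notation "X '⊗' Y" := (tens T X Y) (at level 38, left associativity).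
Local Notation "f '⊠' g" := (tensm T f g) (at level 38, left associativity).

Lemma mem_prerows s1 s2 (u : prerow s1 s2) : u \in prerows s1 s2.
Proof.
case: u => [[q p] r]; apply: allpairs_f_dep; rewrite ?mem_enum //.
by apply: allpairs_f; rewrite mem_enum.
Qed.

Lemma prerows_uniq s1 s2 : uniq (prerows (D := D) s1 s2).
Proof.
apply: allpairs_uniq_dep => [|z _|[z r] [z' r'] _ _ //]; last exact: enum_uniq.
by apply: allpairs_uniq => [||[? ?] [? ?] _ _ //]; exact: enum_uniq.
Qed.

(** Sorting permutes the list of all rows of the product, each of which is
    listed once. *)
Lemma hat_row_bij s1 s2 : bijective (@hat_row _ _ _ D s1 s2).
Proof.
have su : uniq (sorted_prerows (D := D) s1 s2).
  by rewrite sort_uniq prerows_uniq.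
apply: inj_card_bij => [P Q|].
  by move/(elimT (tuple_uniqP (in_tuple _)) su)/cast_ord_inj.
rewrite card_ord -size_sorted_prerows size_sort cardE.
apply: uniq_leq_size (enum_uniq _) _ => u _; exact: mem_prerows.
Qed.

Definition prerow_dsum s1 s2 :
  dsum (fun u : prerow s1 s2 => V (prerow_type u)) (Vm s1 ⊗ Vm s2) :=
  dsum_sigma (tens_dsum hT (pos_dsum s1) (pos_dsum s2))
    (fun z : pos s2 * pos s1 =>
       dsum_iso (pos_dsum (c (blk z.2) (blk z.1)))
         (fr_theta_iso (blk z.2) (blk z.1))).

Lemma prerow_dprE s1 s2 (u : prerow s1 s2) : dpr (prerow_dsum s1 s2) u =
  proj (tagged u) \oC theta _ _ \oC (proj (tag u).2 ⊠ proj (tag u).1).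
Proof. by []. Qed.

Lemma prerow_dinjE s1 s2 (u : prerow s1 s2) : dinj (prerow_dsum s1 s2) u =
  (emb (tag u).2 ⊠ emb (tag u).1) \oC invm (theta _ _) \oC emb (tagged u).
Proof. by rewrite -compA. Qed.

Definition Theta s1 s2 : hom (Vm s1 ⊗ Vm s2) (Vm (hat_ob s1 s2)) :=
  dsum_map (pos_dsum (hat_ob s1 s2)) (prerow_dsum s1 s2)
    (fun P => cast (prerow_type (hat_row P)) (blk P)).

Lemma Theta_iso s1 s2 : is_iso (Theta s1 s2).
Proof.
apply: dsum_map_iso (hat_row_bij s1 s2) _ => P.
exact: cast_iso (hat_row_type P).
Qed.

Lemma proj_Theta s1 s2 (P : pos (hat_ob s1 s2)) :
  proj P \oC Theta s1 s2 =
  cast (prerow_type (hat_row P)) (blk P)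
    \oC dpr (prerow_dsum s1 s2) (hat_row P).
Proof. exact: (dpr_dsum_map (pos_dsum _) (prerow_dsum s1 s2) _ P). Qed.

Lemma Theta_dinj s1 s2 (P : pos (hat_ob s1 s2)) :
  Theta s1 s2 \oC dinj (prerow_dsum s1 s2) (hat_row P) =
  emb P \oC cast (prerow_type (hat_row P)) (blk P).
Proof.
exact: (dsum_map_inj (pos_dsum _) (prerow_dsum s1 s2) _ (hat_row_bij s1 s2)).
Qed.

(** Compare the components from row v of the source to position P of the target.
    On both sides the component is that of theta (x ⊗ y) theta^-1, with x and y
    the entries of X and Y selected by the two rows, and this is how the entry
    of the product matrix is defined. *)
Lemma Theta_nat s1 s2 m1 m2 (X : blockmx (D := D) s1 m1) (Y : blockmx s2 m2) :
  Theta s1 s2 \oC (of_mx X ⊠ of_mx Y) = of_mx (hat_mx X Y) \oC Theta m1 m2.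
Proof.
apply: (dsum_ext_pr (d := pos_dsum _)) => P.
apply: (dsum_ext_inj (d := prerow_dsum m1 m2)) => v.
have [Q <-] : exists Q, hat_row Q = v.
  by case: (hat_row_bij m1 m2) => g _ gK; exists (g v).
change (dpr (pos_dsum (hat_ob s1 s2)) P) with (proj (D := D) P).
rewrite 2!(compA (proj P)) -(compA _ (Theta m1 m2)) Theta_dinj.
rewrite proj_Theta prerow_dprE prerow_dinjE.
rewrite (compA _ (emb Q)) (proj_of_mx_emb (hat_mx X Y)).
rewrite mxE /= /phi mxE of_to_alg.
rewrite -[RHS]compA castK -?hat_row_type // compm1.
rewrite -!proj_of_mx_emb.
by rewrite !(tens_comp hT) !compA.
Qed.

End Theta.

(** * Products with a single indecomposable *)

Lemma allpairs_single (S R : Type) (T : S -> Type) (g : S -> R)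
    (s : seq S) (t : forall x, seq (T x)) :
  (forall x, size (t x) = 1%N) -> [seq g x | x <- s, _ <- t x] = map g s.
Proof.
move=> t1; elim: s => //= x s ->.
by case: (t x) (t1 x) => [|y []].
Qed.

Section HatRow.
Variables (F : fieldType) (C : lincat F) (T : tensor_data C) (D : frame T).

Local Notation I := 'I_(fr_n D).+1.
Local Notation c := (fr_c D).
Local Notation pos m := 'I_(\sum_i fun_of_fin m i)%N.
Local Notation blk p := (tagnat.sig1 p).
Local Notation hat_ob := (hat_ob (D := D)).
Local Notation prerow := (prerow (D := D)).

(** If a numbering of the rows follows their listing and the row types increase
    along it, then the sort changes nothing and the row at position P is
    the one with number P. *)
Lemma hat_row_key s1 s2 (key : prerow s1 s2 -> nat) :
  [seq key u | u <- prerows s1 s2] = iota 0 (size (prerows (D := D) s1 s2)) ->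
  (forall u v, key u <= key v -> prerow_type u <= prerow_type v)%N ->
  forall P, key (hat_row P) = P.
Proof.
move=> hkey mono P.
have sortedE : sorted_prerows s1 s2 = prerows (D := D) s1 s2.
  apply: sorted_sort => [u v w|]; first exact: leq_trans.
  apply: (@sub_sorted _ (relpre key leq)) => [u v|]; first exact: mono.
  by rewrite -sorted_map hkey iota_sorted.
have ltP : (P < size (prerows (D := D) s1 s2))%N.
  by rewrite -sortedE size_sorted_prerows.
rewrite /hat_row (tnth_nth (hat_row P)) /= sortedE -(nth_map _ 0%N) //.
by rewrite hkey nth_iota.
Qed.

Lemma size_pos_delta (i : I) : size (enum (pos (delta i))) = 1%N.
Proof.
rewrite size_enum_ord -[RHS](sum_delta i (fun=> 1%N)).
by apply: eq_bigr => j _; rewrite muln1.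
Qed.

Lemma pos_single n (p q : 'I_n) : n = 1%N -> p = q.
Proof.
by move=> n1; move: p q; rewrite n1 => p q; rewrite !ord1.
Qed.

Lemma pos_delta_eq (i : I) (p q : pos (delta i)) : p = q.
Proof. by apply: pos_single; rewrite -(size_pos_delta i) size_enum_ord. Qed.

(** In a product with e_1 every block c_{1i} or c_{i1} is a single row, so the
    rows are numbered by the positions of the other factor. *)
Lemma hat_row_unitl m (P : pos (hat_ob (delta ord0) m)) :
  (tag (hat_row P)).1 = P :> nat.
Proof.
have t1 (z : pos m * pos (delta ord0)) :
    size (enum (pos (c (blk z.2) (blk z.1)))) = 1%N.
  by rewrite blk_delta fr_c_unitl size_pos_delta.
apply: (hat_row_key (key := fun u : prerow (delta ord0) m => val (tag u).1)).
  suff e : [seq val (tag u).1 | u <- prerows (D := D) (delta ord0) m]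
      = iota 0 (\sum_i m i).
    by rewrite -(size_map (fun u => val (tag u).1)) e size_iota.
  rewrite map_allpairs /= (allpairs_single (fun z => val z.1)) //.
  rewrite map_allpairs /=.
  rewrite (allpairs_single (fun q => val q)) ?val_enum_ord // => _.
  exact: size_pos_delta.
have ty (u : prerow (delta ord0) m) : prerow_type u = blk (tag u).1.
  case: u => [[q p] r]; rewrite /prerow_type /=.
  move: r; rewrite /= blk_delta fr_c_unitl => r; exact: blk_delta.
by move=> u v; rewrite !ty => /tagnat.le_sig1.
Qed.

Lemma hat_row_unitr m (P : pos (hat_ob m (delta ord0))) :
  (tag (hat_row P)).2 = P :> nat.
Proof.
have t1 (z : pos (delta ord0) * pos m) :
    size (enum (pos (c (blk z.2) (blk z.1)))) = 1%N.
  by rewrite (blk_delta z.1) fr_c_unitr size_pos_delta.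
apply: (hat_row_key (key := fun u : prerow m (delta ord0) => val (tag u).2)).
  suff e : [seq val (tag u).2 | u <- prerows (D := D) m (delta ord0)]
      = iota 0 (\sum_i m i).
    by rewrite -(size_map (fun u => val (tag u).2)) e size_iota.
  rewrite map_allpairs /= (allpairs_single (fun z => val z.2)) //.
  rewrite map_allpairs /=.
  case: (enum _) (size_pos_delta ord0) => [|q []] //= _.
  by rewrite cats0 val_enum_ord.
have ty (u : prerow m (delta ord0)) : prerow_type u = blk (tag u).2.
  case: u => [[q p] r]; rewrite /prerow_type /=.
  move: r; rewrite /= (blk_delta q) fr_c_unitr => r; exact: blk_delta.
by move=> u v; rewrite !ty => /tagnat.le_sig1.
Qed.

(** The product of e_i and e_j consists of the single block c_ij, which is listed
    in its own order. *)
Lemma hat_row_delta i j (P : pos (hat_ob (delta i) (delta j))) :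
  tagged (hat_row P) = P :> nat.
Proof.
apply: (hat_row_key
  (key := fun u : prerow (delta i) (delta j) => val (tagged u))).
  rewrite /prerows map_allpairs.
  case: (enum (pos (delta j))) (size_pos_delta j) => [|q []] //= _.
  case: (enum (pos (delta i))) (size_pos_delta i) => [|p []] //= _.
  by rewrite !cats0 size_map size_enum_ord val_enum_ord.
move=> [z r] [z' r'].
have ez : z = z'.
  by case: z z' {r r'} => [? ?] [? ?]; congr (_, _); exact: pos_delta_eq.
by case: _ / ez r' => r' /tagnat.le_sig1.
Qed.

End HatRow.

(** * Theta on units and indecomposables, and the associator *)

Section Basic.
Variables (F : fieldType) (C : lincat F) (T : tensor_data C) (D : frame T).
Hypothesis hT : is_tensor_category T.

Local Notation I := 'I_(fr_n D).+1.
Local Notation NI := {ffun I -> nat}.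
Local Notation V := (fr_V D).
Local Notation Vm := (fr_Vm D).
Local Notation c := (fr_c D).
Local Notation theta := (fr_theta D).
Local Notation pos m := 'I_(\sum_i fun_of_fin m i)%N.
Local Notation blk p := (tagnat.sig1 p).
Local Notation hat_ob := (hat_ob (D := D)).
Local Notation Theta := (Theta (D := D) hT).
Local Notation "f '⊠' g" := (tensm T f g) (at level 38, left associativity).

Lemma proj_eqhom m m' (e : m = m') (P : pos m) (p : pos m') :
  P = p :> nat ->
  proj p \oC eqhom (congr1 Vm e) = cast (blk P) (blk p) \oC proj P.
Proof.
by case: _ / e p => p /val_inj ->; rewrite cast_id comp1m compm1.
Qed.

Lemma cast_proj m (p : pos m) i (k : 'I_(m i)) :
  tagnat.sig p = Tagged (fun j => 'I_(m j)) k ->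
  cast (blk p) i \oC proj p = pr (D := D) k.
Proof.
have gen z : tagnat.sig p = z ->
    cast (blk p) (tag z) \oC proj p = dpr (fr_VmP D m) z.
  by move=> <-; rewrite cast_id comp1m.
exact: gen.
Qed.

Lemma proj_inj m (p : pos m) i (k : 'I_(m i)) :
  tagnat.sig p = Tagged (fun j => 'I_(m j)) k ->
  proj p \oC inj (D := D) k = cast i (blk p).
Proof.
have gen z : tagnat.sig p = z ->
    proj p \oC dinj (fr_VmP D m) z = cast (tag z) (blk p).
  by move=> <-; rewrite cast_id; exact: (dpr_inj (fr_VmP D m)).
exact: gen.
Qed.

Lemma proj_inj0 m (p : pos m) i (k : 'I_(m i)) :
  tagnat.sig p != Tagged (fun j => 'I_(m j)) k -> proj p \oC inj (D := D) k = 0.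
Proof. exact: dpr_inj0. Qed.

Lemma pr_emb m (p : pos m) i (k : 'I_(m i)) :
  tagnat.sig p = Tagged (fun j => 'I_(m j)) k ->
  pr (D := D) k \oC emb (D := D) p = cast (blk p) i.
Proof.
by move/cast_proj <-; rewrite -compA proj_emb compm1.
Qed.

Lemma pr_emb0 m (p : pos m) i (k : 'I_(m i)) :
  tagnat.sig p != Tagged (fun j => 'I_(m j)) k ->
  pr (D := D) k \oC emb (D := D) p = 0.
Proof.
rewrite eq_sym => kp.
exact: (dpr_inj0 (fr_VmP D m) (j := Tagged (fun j => 'I_(m j)) k) kp).
Qed.

Lemma sig_delta (i : I) (p : pos (delta i)) :
  tagnat.sig p = Tagged (fun j => 'I_(delta i j)) (Ordinal (delta_gt0 i)).
Proof. by apply: (can_inj tagnat.rankK); exact: pos_delta_eq. Qed.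

Lemma unit_projK i : unit_emb (D := D) i \oC unit_proj i = idm (Vm (delta i)).
Proof.
apply: hom_ext_pos => p q; rewrite (pos_delta_eq q p) compm1 proj_emb !compA.
rewrite (proj_inj (sig_delta p)) -compA (pr_emb (sig_delta p)).
by rewrite castK // blk_delta.
Qed.

Lemma pr_inj (m : NI) i (k : 'I_(m i)) :
  pr (D := D) k \oC inj (D := D) k = idm (V i).
Proof. exact: (dpr_inj (fr_VmP D m) (Tagged (fun j => 'I_(m j)) k)). Qed.

Lemma unit_embK i : unit_proj (D := D) i \oC unit_emb i = idm (V i).
Proof. exact: pr_inj. Qed.

Lemma of_mx_elt_col (m : NI) i (k : 'I_(m i)) :
  of_mx (elt_col (D := D) k) = inj k \oC unit_proj i.
Proof.
apply: hom_ext_pos => p q; rewrite proj_of_mx_emb mxE.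
rewrite !compA -compA (pr_emb (sig_delta q)).
have -> : (p == tagnat.Rank i k) =
    (tagnat.sig p == Tagged (fun j => 'I_(m j)) k).
  by rewrite -(can_eq tagnat.rankK) tagnat.sigK.
case: eqP => [/proj_inj ->|/eqP/proj_inj0 ->]; last by rewrite of_alg0 comp0l.
by rewrite /of_alg /idem /cast !compA.
Qed.

Lemma of_mx_elt_row (m : NI) i (k : 'I_(m i)) :
  of_mx (elt_row (D := D) k) = unit_emb i \oC pr k.
Proof.
apply: hom_ext_pos => p q; rewrite proj_of_mx_emb mxE.
rewrite !compA (proj_inj (sig_delta p)) -compA.
have -> : (q == tagnat.Rank i k) =
    (tagnat.sig q == Tagged (fun j => 'I_(m j)) k).
  by rewrite -(can_eq tagnat.rankK) tagnat.sigK.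
case: eqP => [/pr_emb ->|/eqP/pr_emb0 ->]; last by rewrite of_alg0 comp0r.
by rewrite /of_alg /idem /cast !compA.
Qed.

Lemma sum_inj_pr (m : NI) :
  \sum_i \sum_(k < m i) (inj (D := D) k \oC pr k) = idm (Vm m).
Proof.
rewrite -(dsum_id (fr_VmP D m)) sig_big_dep /=.
by apply: eq_bigr => -[i k] _.
Qed.

(** Positions of V^(e_i) lie in block i only propositionally, hence the
    indices i' and j', to be replaced by i and j. *)
Lemma theta_cast i i' j j' (r : pos (c i' j')) (p : pos (c i j)) :
  i' = i -> j' = j -> r = p :> nat ->
  cast (blk r) (blk p) \oC proj r \oC theta i' j' =
  proj p \oC theta i j \oC (cast i' i ⊠ cast j' j).
Proof.
move=> ei ej; case: _ / ei p; case: _ / ej => p /val_inj ->.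
by rewrite !cast_id tens_id // comp1m compm1.
Qed.

Lemma proj_Theta_cast s1 s2 (P : pos (hat_ob s1 s2)) k :
  cast (blk P) k \oC proj P \oC Theta s1 s2 =
  cast (prerow_type (hat_row P)) k \oC proj (tagged (hat_row P))
    \oC theta _ _ \oC (proj (tag (hat_row P)).2 ⊠ proj (tag (hat_row P)).1).
Proof.
rewrite -compA proj_Theta compA cast_trans ?hat_row_type //.
by rewrite prerow_dprE !compA.
Qed.

(** On two indecomposables Theta is theta_ij, up to the identifications of V_i
    with V^(e_i) and of the product of e_i and e_j with c_ij. *)
Lemma Theta_delta i j :
  eqhom (congr1 Vm (hat_ob_delta i j)) \oC Theta (delta i) (delta j) =
  theta i j \oC (unit_proj i ⊠ unit_proj j).
Proof.
apply: (dsum_ext_pr (d := pos_dsum _)) => p; rewrite -projE.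
pose P : pos (hat_ob (delta i) (delta j)) :=
  cast_ord (congr1 (fun m : NI => (\sum_i m i)%N) (esym (hat_ob_delta i j))) p.
rewrite !compA (proj_eqhom _ (P := P)) // proj_Theta_cast.
have := hat_row_delta P; case: (hat_row P) => [[q p0] r] /= rP.
rewrite (theta_cast (blk_delta p0) (blk_delta q) (rP : r = p :> nat)).
rewrite -!compA; do 2!congr (_ \oC _); rewrite -tens_comp //.
by rewrite (cast_proj (sig_delta p0)) (cast_proj (sig_delta q)).
Qed.

Definition hat_unit : hom (tunit T) (Vm (delta ord0)) :=
  unit_emb ord0 \oC eqhom (esym (fr_V0 D)).

Lemma eqhomK (X Y : C) (e : X = Y) : eqhom e \oC eqhom (esym e) = idm Y.
Proof. by case: _ / e; rewrite comp1m. Qed.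

Lemma eqhom_congrVK (A : Type) (f : A -> C) (x y : A) (e : x = y) :
  eqhom (congr1 f (esym e)) \oC eqhom (congr1 f e) = idm (f x).
Proof. by case: _ / e; rewrite comp1m. Qed.

Lemma hat_unit_iso : is_iso hat_unit.
Proof.
apply: is_iso_comp (is_iso_eqhom _).
exact: is_isoI (unit_embK _) (unit_projK _).
Qed.

(** This is where the normalization of theta_{1j} enters: with V_1 identified
    with the unit object, its only component is the left unit constraint of C. *)
Lemma theta_unitl i0 j (r : pos (c i0 j)) : i0 = ord0 ->
  cast (blk r) j \oC proj r \oC theta i0 j
    \oC ((cast ord0 i0 \oC eqhom (esym (fr_V0 D))) ⊠ idm (V j)) =
  tlunit T (V j).
Proof.
move=> ei; move: r; rewrite ei cast_id comp1m => r.
have lt1 : (0 < c ord0 j j)%N by rewrite fr_c_unitl delta_gt0.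
have sr : tagnat.sig r = Tagged (fun i => 'I_(c ord0 j i)) (Ordinal lt1).
  apply: (can_inj tagnat.rankK); apply: pos_single; rewrite fr_c_unitl.
  by rewrite -(size_pos_delta j) size_enum_ord.
rewrite (cast_proj sr) (fr_theta_unitl (Ordinal lt1)).
rewrite -[dinj _ _]/(inj (Ordinal lt1)) !compA pr_inj comp1m.
by rewrite -compA -tens_comp // eqhomK comp1m tens_id // compm1.
Qed.

Lemma theta_unitr i j0 (r : pos (c i j0)) : j0 = ord0 ->
  cast (blk r) i \oC proj r \oC theta i j0
    \oC (idm (V i) ⊠ (cast ord0 j0 \oC eqhom (esym (fr_V0 D)))) =
  trunit T (V i).
Proof.
move=> ej; move: r; rewrite ej cast_id comp1m => r.
have lt1 : (0 < c i ord0 i)%N by rewrite fr_c_unitr delta_gt0.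
have sr : tagnat.sig r = Tagged (fun j => 'I_(c i ord0 j)) (Ordinal lt1).
  apply: (can_inj tagnat.rankK); apply: pos_single; rewrite fr_c_unitr.
  by rewrite -(size_pos_delta i) size_enum_ord.
rewrite (cast_proj sr) (fr_theta_unitr (Ordinal lt1)).
rewrite -[dinj _ _]/(inj (Ordinal lt1)) !compA pr_inj comp1m.
by rewrite -compA -tens_comp // eqhomK comp1m tens_id // compm1.
Qed.

Lemma proj_hat_unit (p : pos (delta ord0)) :
  proj p \oC hat_unit = cast ord0 (blk p) \oC eqhom (esym (fr_V0 D)).
Proof. by rewrite compA (proj_inj (sig_delta p)). Qed.

Lemma Theta_unitl m :
  eqhom (congr1 Vm (hat_ob_unitl m)) \oC Theta (delta ord0) m
    \oC (hat_unit ⊠ idm (Vm m)) = tlunit T (Vm m).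
Proof.
apply: (dsum_ext_pr (d := pos_dsum _)) => p; rewrite -projE.
pose P : pos (hat_ob (delta ord0) m) :=
  cast_ord (congr1 (fun m : NI => (\sum_i m i)%N) (esym (hat_ob_unitl m))) p.
rewrite !compA (proj_eqhom _ (P := P)) // proj_Theta_cast.
have := hat_row_unitl P; case: (hat_row P) => [[q p0] r] /= qP.
have {qP} eq : q = p by exact: val_inj.
case: _ / eq in r *.
rewrite -[cast _ _]/(cast (blk r) (blk q)).
rewrite -(tlunit_nat hT) -(theta_unitl r (blk_delta p0)).
rewrite -[LHS]compA -[RHS]compA -!(tens_comp hT).
by rewrite proj_hat_unit comp1m !compm1.
Qed.

Lemma Theta_unitr m :
  eqhom (congr1 Vm (hat_ob_unitr m)) \oC Theta m (delta ord0)
    \oC (idm (Vm m) ⊠ hat_unit) = trunit T (Vm m).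
Proof.
apply: (dsum_ext_pr (d := pos_dsum _)) => p; rewrite -projE.
pose P : pos (hat_ob m (delta ord0)) :=
  cast_ord (congr1 (fun m : NI => (\sum_i m i)%N) (esym (hat_ob_unitr m))) p.
rewrite !compA (proj_eqhom _ (P := P)) // proj_Theta_cast.
have := hat_row_unitr P; case: (hat_row P) => [[q p'] r] /= pP.
have {pP} ep : p' = p by exact: val_inj.
case: _ / ep in r *; rewrite -[cast _ _]/(cast (blk r) (blk p')).
rewrite -(trunit_nat hT) -(theta_unitr r (blk_delta q)).
rewrite -[LHS]compA -[RHS]compA -!(tens_comp hT).
by rewrite proj_hat_unit comp1m !compm1.
Qed.

(** By naturality of Theta and [Theta_delta], the term of theta(m, s) at two
    summands is Theta composed with the idempotents of these summands, and
    the idempotents add up to the identity. *)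
Lemma theta_extE m s : theta_ext m s = Theta m s.
Proof.
have thetaE i j : theta i j = eqhom (congr1 Vm (hat_ob_delta i j))
    \oC Theta (delta i) (delta j) \oC (unit_emb i ⊠ unit_emb j).
  by rewrite Theta_delta -compA -tens_comp // !unit_embK tens_id // compm1.
have term i j (k : 'I_(m i)) (l : 'I_(s j)) :
    of_mx (hat_mx (elt_col k) (elt_col l))
       \oC eqhom (congr1 Vm (esym (hat_ob_delta i j)))
       \oC theta i j \oC (pr k ⊠ pr l) =
    Theta m s \oC ((inj k \oC pr k) ⊠ (inj l \oC pr l)).
  rewrite thetaE !compA -(compA _ (eqhom _) (eqhom _)) eqhom_congrVK compm1.
  rewrite -Theta_nat !of_mx_elt_col -!compA; congr (_ \oC _).
  rewrite -!tens_comp // -!compA (compA (unit_proj i)) (compA (unit_proj j)).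
  by rewrite !unit_embK !comp1m.
rewrite -[RHS]compm1 -(tens_id hT) -(sum_inj_pr m) -(sum_inj_pr s).
rewrite (tens_suml hT) comp_sumr; apply: eq_bigr => i _.
rewrite (tens_sumr hT) comp_sumr; apply: eq_bigr => j _.
rewrite (tens_suml hT) comp_sumr; apply: eq_bigr => k _.
rewrite (tens_sumr hT) comp_sumr; apply: eq_bigr => l _.
exact: term.
Qed.

Section Associator.

Lemma Theta_eqhom_l s s' m (e : s = s') :
  eqhom (congr1 Vm (congr1 (fun x => hat_ob x m) e)) \oC Theta s m =
  Theta s' m \oC (eqhom (congr1 Vm e) ⊠ idm (Vm m)).
Proof. by case: _ / e; rewrite /= comp1m tens_id // compm1. Qed.

Lemma Theta_eqhom_r s s' m (e : s = s') :
  eqhom (congr1 Vm (congr1 (hat_ob m) e)) \oC Theta m s =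
  Theta m s' \oC (idm (Vm m) ⊠ eqhom (congr1 Vm e)).
Proof. by case: _ / e; rewrite /= comp1m tens_id // compm1. Qed.

Local Notation phi := (fmor (realize D)).

(** The definition of a_{i,j,l} conjugates the constraint of C by the
    comparison maps theta(c_ij, e_l) (theta_ij ⊗ 1) and
    theta(e_i, c_jl) (1 ⊗ theta_jl); what remains is to move the identifications
    of c_ij with the product of e_i and e_j through Theta. *)
Lemma assoc_basicE i j l :
  phi (assoc_basic i j l) \oC Theta (hat_ob (delta i) (delta j)) (delta l)
    \oC (Theta (delta i) (delta j) ⊠ idm (Vm (delta l))) =
  Theta (delta i) (hat_ob (delta j) (delta l))
    \oC (idm (Vm (delta i)) ⊠ Theta (delta j) (delta l))
    \oC tassoc T (Vm (delta i)) (Vm (delta j)) (Vm (delta l)).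
Proof.
rewrite /assoc_basic !fmor_comp !fmor_eqhom.
have -> : phi (to_mx (assoc_core i j l)) = assoc_core i j l by exact: to_mxK.
rewrite /assoc_core !theta_extE.
have El := Theta_eqhom_l (delta l) (hat_ob_delta i j).
have Er := Theta_eqhom_r (delta i) (esym (hat_ob_delta j l)).
rewrite (comp_reassoc El) !compA.
rewrite -[eqhom (congr1 (realize D) _)]/(eqhom (congr1 Vm _)) Er.
rewrite (compKVm _ (Theta_iso hT _ _)).
have projl : (invm (theta i j) ⊠ unit_proj l)
      \oC (eqhom (congr1 Vm (hat_ob_delta i j)) ⊠ idm (Vm (delta l)))
      \oC (Theta (delta i) (delta j) ⊠ idm (Vm (delta l))) =
    (unit_proj i ⊠ unit_proj j) ⊠ unit_proj l.
  rewrite -!(tens_comp hT) -compA Theta_delta compA compVm ?comp1m ?compm1 //.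
  exact: fr_theta_iso.
have projr : (idm (Vm (delta i)) ⊠ eqhom (congr1 Vm (esym (hat_ob_delta j l))))
      \oC (unit_emb i ⊠ theta j l)
      \oC (unit_proj i ⊠ (unit_proj j ⊠ unit_proj l)) =
    idm (Vm (delta i)) ⊠ Theta (delta j) (delta l).
  rewrite -!(tens_comp hT) comp1m unit_projK -compA -Theta_delta compA.
  by rewrite eqhom_congrVK comp1m.
rewrite (comp_reassoc3 projl) (comp_reassoc (tassoc_nat hT _ _ _)) !compA.
by rewrite (comp_reassoc3 projr).
Qed.

Lemma Theta_nat3l s1 s2 s3 m1 m2 m3 (X : blockmx (D := D) s1 m1)
    (Y : blockmx (D := D) s2 m2) (Z : blockmx (D := D) s3 m3) :
  of_mx (hat_mx (hat_mx X Y) Z) \oC Theta (hat_ob m1 m2) m3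
    \oC (Theta m1 m2 ⊠ idm (Vm m3)) =
  Theta (hat_ob s1 s2) s3 \oC (Theta s1 s2 ⊠ idm (Vm s3))
    \oC ((of_mx X ⊠ of_mx Y) ⊠ of_mx Z).
Proof.
rewrite -Theta_nat -!compA; congr (_ \oC _).
by rewrite -!(tens_comp hT) -Theta_nat comp1m compm1.
Qed.

Lemma Theta_nat3r s1 s2 s3 m1 m2 m3 (X : blockmx (D := D) s1 m1)
    (Y : blockmx (D := D) s2 m2) (Z : blockmx (D := D) s3 m3) :
  of_mx (hat_mx X (hat_mx Y Z)) \oC Theta m1 (hat_ob m2 m3)
    \oC (idm (Vm m1) ⊠ Theta m2 m3) =
  Theta s1 (hat_ob s2 s3) \oC (idm (Vm s1) ⊠ Theta s2 s3)
    \oC (of_mx X ⊠ (of_mx Y ⊠ of_mx Z)).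
Proof.
rewrite -Theta_nat -!compA; congr (_ \oC _).
by rewrite -!(tens_comp hT) -Theta_nat comp1m compm1.
Qed.

Lemma elt_col_rowE (m : NI) i (k : 'I_(m i)) :
  of_mx (elt_col (D := D) k) \oC of_mx (elt_row (D := D) k) = inj k \oC pr k.
Proof.
rewrite of_mx_elt_col of_mx_elt_row !compA -(compA _ (unit_proj i)).
by rewrite unit_embK compm1.
Qed.

(** Each term of a_{m,s,t} is treated by naturality of Theta in the rows, the
    basic case, naturality of the constraint of C, and naturality of Theta in
    the columns; a row followed by the matching column is the idempotent of a
    summand, and the triple products of these idempotents add up to 1. *)
Lemma Theta_assoc m s t :
  phi (hat_assoc m s t) \oC Theta (hat_ob m s) t
    \oC (Theta m s ⊠ idm (Vm t)) =
  Theta m (hat_ob s t) \oC (idm (Vm m) ⊠ Theta s t)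
    \oC tassoc T (Vm m) (Vm s) (Vm t).
Proof.
have term i j l (k1 : 'I_(m i)) (k2 : 'I_(s j)) (k3 : 'I_(t l)) :
    phi ((hat_mx (elt_col k1) (hat_mx (elt_col k2) (elt_col k3))
        : @hom F (hat_cat D) _ _)
       \oC assoc_basic i j l
       \oC (hat_mx (hat_mx (elt_row k1) (elt_row k2)) (elt_row k3)
              : @hom F (hat_cat D) _ _))
      \oC Theta (hat_ob m s) t \oC (Theta m s ⊠ idm (Vm t)) =
    Theta m (hat_ob s t) \oC (idm (Vm m) ⊠ Theta s t)
      \oC ((inj k1 \oC pr k1) ⊠ ((inj k2 \oC pr k2) ⊠ (inj k3 \oC pr k3)))
      \oC tassoc T (Vm m) (Vm s) (Vm t).
  rewrite 2!fmor_comp.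
  rewrite (comp_reassoc3 (Theta_nat3l (elt_row k1) (elt_row k2) (elt_row k3))).
  rewrite 2!compA (comp_reassoc3 (assoc_basicE i j l)) 2!compA.
  rewrite (comp_reassoc (tassoc_nat hT _ _ _)) compA; congr (_ \oC _).
  rewrite [X in X \oC _](Theta_nat3r (elt_col k1) (elt_col k2) (elt_col k3)).
  by rewrite -[LHS]compA -!(tens_comp hT) !elt_col_rowE.
(* Theta is itself a sum: it is made abstract so that only the six sums of the
   definition of a_{m,s,t} are distributed, in the order of that definition. *)
move: term; move: (Theta (hat_ob m s) t) (Theta m s ⊠ idm (Vm t)).
move: (Theta m (hat_ob s t) \oC _) => A B1 B2 term.
have phi_sum := fmor_sum (realize D).
rewrite /hat_assoc.
rewrite -[X in _ = X \oC _]compm1 -2!(tens_id hT).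
rewrite -(sum_inj_pr m) -(sum_inj_pr s) -(sum_inj_pr t).
rewrite phi_sum (tens_suml hT) comp_sumr !comp_suml; apply: eq_bigr => i _.
rewrite phi_sum [X in _ ⊠ X](tens_suml hT) (tens_sumr hT) comp_sumr.
rewrite !comp_suml; apply: eq_bigr => j _.
rewrite phi_sum [X in _ ⊠ X](tens_sumr hT) (tens_sumr hT) comp_sumr.
rewrite !comp_suml; apply: eq_bigr => l _.
rewrite phi_sum (tens_suml hT) comp_sumr !comp_suml; apply: eq_bigr => k1 _.
rewrite phi_sum (tens_suml hT) (tens_sumr hT) comp_sumr.
rewrite !comp_suml; apply: eq_bigr => k2 _.
rewrite phi_sum !(tens_sumr hT) comp_sumr !comp_suml; apply: eq_bigr => k3 _.
exact: term.
Qed.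

End Associator.
End Basic.

(** * The tensor equivalence *)

Section Realization.
Variables (F : fieldType) (C : lincat F) (T : tensor_data C) (D : frame T).
Hypothesis hT : is_tensor_category T.

Definition realize_tensor : tensor_functor (hat_tensor D) T.
Proof.
apply: (@TensorFunctor F (hat_cat D) C (hat_tensor D) T (realize D)
  (hat_unit D) (Theta (D := D) hT) (hat_unit_iso D) (Theta_iso hT)).
- by move=> m m' s s' X Y; exact: Theta_nat.
- exact: Theta_assoc.
- by move=> m; rewrite -(Theta_unitl hT m) fmor_eqhom.
- by move=> m; rewrite -(Theta_unitr hT m) fmor_eqhom.
Defined.

End Realization.

Theorem theorem3p21 (F : closedFieldType) (C : lincat F) (T : tensor_data C)
    (hC : standing_assumptions T) (D : frame T) :
  is_tensor_category (hat_tensor D) /\ tensor_equivalent (hat_tensor D) T.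
Proof.
have hT := sa_tensor hC.
split.
  exact: (pullback_tensor_category (G := realize_tensor D hT) hT
    (@realize_full _ _ _ D) (@realize_faithful _ _ _ D)).
exists (realize_tensor D hT).
apply: ff_es_equivalence (@realize_full _ _ _ D) (@realize_faithful _ _ _ D) _.
exact: realize_essentially_surjective (sa_krull_schmidt hC).
Qed.
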